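(* Let $\mathcal X=(\mathcal X_1,\mathcal X_2,\mu,\partial)$ be a finite crossed module and let $G(\mathcal X)=(\ker\partial)^*\rtimes_{\hat\mu}(\mathrm{coker}\,\partial)$. Then the category $G(\mathcal X)\text{-}\mathrm{Rep}$ of finite-dimensional representations of $G(\mathcal X)$ over $k$ is equivalent, as a tensor category, to the full tensor subcategory $\mathcal M(\mathcal X)^T$ of transparent objects of $\mathcal M(\mathcal X)$.
   Context: Throughout, $k$ is an algebraically closed field of characteristic zero. Crossed modules. A finite crossed module $\mathcal X=(\mathcal X_1,\mathcal X_2,\mu,\partial)$ consists of finite groups $\mathcal X_1,\mathcal X_2$, a right action $\mu$ of $\mathcal X_1$ on $\mathcal X_2$ by group automorphisms, written $\mu(m,g)=m^g$, and a group homomorphism (boundary map) $\partial:\mathcal X_2\to\mathcal X_1$ with $\partial(m^g)=g^{-1}(\partial m)g$ and $m^{\partial n}=n^{-1}mn$ for all $m,n\in\mathcal X_2$, $g\in\mathcal X_1$. Then $\ker\partial$ is central in $\mathcal X_2$ and $I:=\mathrm{Im}\,\partial$ is normal in $\mathcal X_1$; $\mathrm{coker}\,\partial=\mathcal X_1/I$. The category $\mathcal M(\mathcal X)$. Objects are triples $(V,P,Q)$: a finite-dimensional $\mathcal X_2$-graded $k$-vector space $V=\bigoplus_{m\in\mathcal X_2}V_m$, where $P(m)$ is the projection to $V_m$, with an action $Q:\mathcal X_1\to\mathrm{Aut}(V)$ such that $P(m)Q(g)=Q(g)P(m^g)$ for all $m\in\mathcal X_2,g\in\mathcal X_1$. Morphisms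 are linear maps preserving grading and action. Tensor product: that of vector spaces, with $(V\otimes W)_m=\bigoplus_{nl=m}V_n\otimes W_l$ and diagonal action. Braiding: $R_{VW}(v\otimes w)=\sum_{m\in\mathcal X_2}Q_W(\partial m)w\otimes P_V(m)v$. An object $X$ of a braided tensor category $\mathcal C$ is transparent if $R_{Y,X}=R_{X,Y}^{-1}$ for all $Y\in\mathcal C$. The group $G(\mathcal X)$. The action $\mu$ induces a right action of $\mathrm{coker}\,\partial$ on the finite abelian group $\ker\partial$ by $k^{Ig}:=k^g$. Let $(\ker\partial)^*$ be the group of characters of $\ker\partial$ with values in the base field; it carries the dual right action $\hat\mu$ of $\mathrm{coker}\,\partial$, $\chi^c(x):=\chi(x^{c^{-1}})$. $G(\mathcal X)$ is the semidirect product, i.e. the set $(\ker\partial)^*\times\mathrm{coker}\,\partial$ with multiplication $(\chi_1,c_1)(\chi_2,c_2)=(\chi_1^{c_2}\chi_2,\,c_1c_2)$. *)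

(* Defs.v *)
From HB Require Import structures.
From mathcomp Require Import all_boot all_order all_algebra all_fingroup.
From mathcomp Require Import boolp.

Set Implicit Arguments.
Unset Strict Implicit.
Unset Printing Implicit Defensive.

Import GRing.Theory.
Local Open Scope ring_scope.

Definition bilin (k : fieldType) (V W U : lmodType k) (b : V -> W -> U) : Prop :=
  (forall w, linear (b ^~ w)) /\ (forall v, linear (b v)).

Section Bilinear.
Variables (k : fieldType) (V W U : lmodType k) (b : V -> W -> U).
Hypothesis bb : bilin b.

Lemma bilinDl v1 v2 w : b (v1 + v2) w = b v1 w + b v2 w.
Proof. by have := bb.1 w 1 v1 v2; rewrite !scale1r. Qed.

Lemma bilinDr v w1 w2 : b v (w1 + w2) = b v w1 + b v w2.
Proof. by have := bb.2 v 1 w1 w2; rewrite !scale1r. Qed.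

Lemma bilin0l w : b 0 w = 0.
Proof. by apply: (addrI (b 0 w)); rewrite -bilinDl !addr0. Qed.

Lemma bilin0r v : b v 0 = 0.
Proof. by apply: (addrI (b v 0)); rewrite -bilinDr !addr0. Qed.

Lemma bilinZl a v w : b (a *: v) w = a *: b v w.
Proof. by have := bb.1 w a v 0; rewrite !addr0 bilin0l addr0. Qed.

Lemma bilinZr a v w : b v (a *: w) = a *: b v w.
Proof. by have := bb.2 v a w 0; rewrite !addr0 bilin0r addr0. Qed.

Lemma bilin_suml I (r : seq I) (P : pred I) F w :
  b (\sum_(i <- r | P i) F i) w = \sum_(i <- r | P i) b (F i) w.
Proof.
exact: (big_morph (b ^~ w) (fun x y => bilinDl x y w) (bilin0l w)).
Qed.

Lemma bilin_sumr I (r : seq I) (P : pred I) F v :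
  b v (\sum_(i <- r | P i) F i) = \sum_(i <- r | P i) b v (F i).
Proof. exact: (big_morph (b v) (bilinDr v) (bilin0r v)). Qed.

End Bilinear.

Section TensorProduct.
Variable k : fieldType.
Implicit Types V W U Y Z : vectType k.

(* MathComp has no tensor product of vectTypes.  The model is the space of
   matrices indexed by bases of V and W; [tliftE] and [tens_ext] are the
   universal property, and nothing below depends on the bases. *)
Definition tensV V W : vectType k :=
  'M[k]_(\dim (@fullv k V), \dim (@fullv k W)).

Definition tensv V W (v : V) (w : W) : tensV V W :=
  \matrix_(i, j) (coord (vbasis fullv) i v * coord (vbasis fullv) j w).

(* Only the values of b on pairs of basis vectors are used, so [tlift b] is
   defined for every b; it is meaningful when b is bilinear. *)
Definition tlift_fun V W U (b : V -> W -> U) (A : tensV V W) : U :=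
  \sum_i \sum_j (A : 'M_(_, _)) i j *: b (vbasis fullv)`_i (vbasis fullv)`_j.

Definition tlift V W U (b : V -> W -> U) : 'Hom(tensV V W, U) :=
  linfun (tlift_fun b).

Lemma tlift_fun_linear V W U (b : V -> W -> U) : linear (tlift_fun b).
Proof.
move=> a A B; rewrite /tlift_fun scaler_sumr -big_split /=; apply: eq_bigr => i _.
rewrite scaler_sumr -big_split /=; apply: eq_bigr => j _.
by rewrite !mxE scalerDl scalerA.
Qed.

Lemma tliftFE V W U (b : V -> W -> U) A : tlift b A = tlift_fun b A.
Proof.
have lin := tlift_fun_linear b.
pose ff := GRing.isLinear.Build k (tensV V W) U _ (tlift_fun b) lin.
pose fL : {linear tensV V W -> U} := HB.pack (tlift_fun b) ff.
by rewrite /tlift (lfunE fL).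
Qed.

Lemma tensv_bilin V W : bilin (@tensv V W).
Proof.
split=> [w|v] a x y; apply/matrixP => i j; rewrite !mxE linearP.
  by rewrite mulrDl mulrA.
by rewrite mulrDr mulrCA.
Qed.

Lemma tliftE V W U (b : V -> W -> U) :
  bilin b -> forall v w, tlift b (tensv v w) = b v w.
Proof.
move=> bb v w; rewrite tliftFE /tlift_fun.
rewrite [in RHS](coord_vbasis (memvf v)) bilin_suml //; apply: eq_bigr => i _.
rewrite [in RHS](coord_vbasis (memvf w)) bilin_sumr //; apply: eq_bigr => j _.
by rewrite bilinZl // bilinZr // scalerA mxE.
Qed.

Lemma tens_ext V W U (f g : 'Hom(tensV V W, U)) :
  (forall v w, f (tensv v w) = g (tensv v w)) -> f = g.
Proof.
move=> fg; apply/lfunP => A.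
have -> : A = \sum_i \sum_j
    (A : 'M_(_, _)) i j *: tensv (vbasis fullv)`_i (vbasis fullv)`_j :> tensV V W.
  rewrite {1}[A]matrix_sum_delta; apply: eq_bigr => i _; apply: eq_bigr => j _.
  congr (_ *: _); apply/matrixP => i' j'; rewrite !mxE.
  by rewrite !coord_free ?(basis_free (vbasisP _)) // -natrM mulnb [i == _]eq_sym
     [j == _]eq_sym.
rewrite !linear_sum; apply: eq_bigr => i _; rewrite !linear_sum.
by apply: eq_bigr => j _; rewrite !linearZ /= fg.
Qed.

Definition tensl V W (w : W) : 'Hom(V, tensV V W) := linfun (fun v : V => tensv v w).
Definition tensr V W (v : V) : 'Hom(W, tensV V W) := linfun (fun w : W => tensv v w).

Lemma tenslE V W (w : W) (v : V) : tensl V w v = tensv v w.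
Proof.
pose fL : {linear V -> tensV V W} := HB.pack (fun v : V => tensv v w)
  (GRing.isLinear.Build k V _ _ _ ((tensv_bilin V W).1 w)).
exact: (lfunE fL).
Qed.

Lemma tensrE V W (v : V) (w : W) : tensr W v w = tensv v w.
Proof.
pose fL : {linear W -> tensV V W} := HB.pack (fun w : W => tensv v w)
  (GRing.isLinear.Build k W _ _ _ ((tensv_bilin V W).2 v)).
exact: (lfunE fL).
Qed.

Lemma tens_ext3l V W U Z (f g : 'Hom(tensV (tensV V W) U, Z)) :
  (forall v w u, f (tensv (tensv v w) u) = g (tensv (tensv v w) u)) -> f = g.
Proof.
move=> fg; apply: tens_ext => x u; rewrite -tenslE -!comp_lfunE.
congr (fun_of_lfun _ x); apply: tens_ext => v w.
by rewrite !comp_lfunE tenslE fg.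
Qed.

Lemma tens_ext3r V W U Z (f g : 'Hom(tensV V (tensV W U), Z)) :
  (forall v w u, f (tensv v (tensv w u)) = g (tensv v (tensv w u))) -> f = g.
Proof.
move=> fg; apply: tens_ext => v x; rewrite -tensrE -!comp_lfunE.
congr (fun_of_lfun _ x); apply: tens_ext => w u.
by rewrite !comp_lfunE tensrE fg.
Qed.

Lemma tens_ext4 V W U Y Z (f g : 'Hom(tensV (tensV (tensV V W) U) Y, Z)) :
  (forall v w u y, f (tensv (tensv (tensv v w) u) y) =
                   g (tensv (tensv (tensv v w) u) y)) -> f = g.
Proof.
move=> fg; apply: tens_ext => x y; rewrite -tenslE -!comp_lfunE.
congr (fun_of_lfun _ x); apply: tens_ext3l => v w u.
by rewrite !comp_lfunE tenslE fg.
Qed.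

Lemma bilinC V W U (b : V -> W -> U) : bilin b -> bilin (fun w v => b v w).
Proof. by case. Qed.

Lemma bilin_lfun V W U Z (b : V -> W -> U) (f : 'Hom(U, Z)) :
  bilin b -> bilin (fun v w => f (b v w)).
Proof. by move=> bb; split=> ? a x y; rewrite ?bb.1 ?bb.2 linearP. Qed.

Lemma bilin_lfun2 V W V' W' U (b : V -> W -> U) (f : 'Hom(V', V)) (g : 'Hom(W', W)) :
  bilin b -> bilin (fun v w => b (f v) (g w)).
Proof. by move=> bb; split=> ? a x y; rewrite linearP ?bb.1 ?bb.2. Qed.

Lemma bilin_sum V W U I (r : seq I) (P : pred I) (b : I -> V -> W -> U) :
  (forall i, bilin (b i)) -> bilin (fun v w => \sum_(i <- r | P i) b i v w).
Proof.
move=> bb; split=> c a x y; rewrite scaler_sumr -big_split /=;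
by apply: eq_bigr => i _; rewrite ?(bb i).1 ?(bb i).2.
Qed.

Lemma bilin_tlift V W U Z (b : U -> V -> W -> Z) :
  (forall u, bilin (b u)) -> (forall v w, linear (fun u => b u v w)) ->
  bilin (fun u x => tlift (b u) x).
Proof.
move=> bb lb; split=> [x|u] a y z; last by rewrite linearP.
rewrite -scale_lfunE -add_lfunE; congr (fun_of_lfun _ x).
apply: tens_ext => v w.
by rewrite add_lfunE scale_lfunE !tliftE ?lb.
Qed.

Definition tmap V W V' W' (f : 'Hom(V, V')) (g : 'Hom(W, W')) :
    'Hom(tensV V W, tensV V' W') :=
  tlift (fun v w => tensv (f v) (g w)).

Definition tassoc V W U : 'Hom(tensV (tensV V W) U, tensV V (tensV W U)) :=
  tlift (fun x u => tlift (fun v w => tensv v (tensv w u)) x).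

Definition tassoci V W U : 'Hom(tensV V (tensV W U), tensV (tensV V W) U) :=
  tlift (fun v x => tlift (fun w u => tensv (tensv v w) u) x).

Definition tlunit V : 'Hom(tensV k^o V, V) := tlift (fun (a : k^o) v => a *: v).
Definition tluniti V : 'Hom(V, tensV k^o V) := tensr V (1 : k^o).
Definition trunit V : 'Hom(tensV V k^o, V) := tlift (fun v (a : k^o) => a *: v).
Definition truniti V : 'Hom(V, tensV V k^o) := tensl V (1 : k^o).

Lemma tmapE V W V' W' (f : 'Hom(V, V')) (g : 'Hom(W, W')) v w :
  tmap f g (tensv v w) = tensv (f v) (g w).
Proof. by rewrite tliftE //; apply/bilin_lfun2/tensv_bilin. Qed.

Lemma tassocE V W U (v : V) (w : W) (u : U) :
  tassoc V W U (tensv (tensv v w) u) = tensv v (tensv w u).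
Proof.
have b1 (u' : U) : bilin (fun (v : V) (w : W) => tensv v (tensv w u')).
  by split=> c a x y; rewrite !((tensv_bilin _ _).1, (tensv_bilin _ _).2).
rewrite !tliftE //; apply: bilinC; apply: bilin_tlift => // v' w' a x y.
by rewrite !(tensv_bilin _ _).2.
Qed.

Lemma tassociE V W U (v : V) (w : W) (u : U) :
  tassoci V W U (tensv v (tensv w u)) = tensv (tensv v w) u.
Proof.
have b1 (v' : V) : bilin (fun (w : W) (u : U) => tensv (tensv v' w) u).
  by split=> c a x y; rewrite !((tensv_bilin _ _).1, (tensv_bilin _ _).2).
rewrite !tliftE //; apply: bilin_tlift => // v' w' a x y.
by rewrite !(tensv_bilin _ _).1.
Qed.

Lemma tlunitE V (a : k^o) (v : V) : tlunit V (tensv a v) = a *: v.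
Proof.
rewrite tliftE //; split=> [u|b] c x y.
  by rewrite scalerDl scalerA.
by rewrite scalerDr !scalerA mulrC.
Qed.

Lemma trunitE V (a : k^o) (v : V) : trunit V (tensv v a) = a *: v.
Proof.
rewrite tliftE //; split=> [u|b] c x y.
  by rewrite scalerDr !scalerA mulrC.
by rewrite scalerDl scalerA.
Qed.

Lemma tlunitiE V (v : V) : tluniti V v = tensv (1 : k^o) v.
Proof. exact: tensrE. Qed.

Lemma trunitiE V (v : V) : truniti V v = tensv v (1 : k^o).
Proof. exact: tenslE. Qed.

Lemma tmap1 V W : tmap (\1 : 'End(V)) (\1 : 'End(W)) = \1%VF.
Proof. by apply: tens_ext => v w; rewrite tmapE !id_lfunE. Qed.

Lemma tmap_comp V W V' W' V'' W'' (f : 'Hom(V, V')) (g : 'Hom(W, W'))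
    (f' : 'Hom(V', V'')) (g' : 'Hom(W', W'')) :
  (tmap (f' \o f) (g' \o g) = tmap f' g' \o tmap f g)%VF.
Proof. by apply: tens_ext => v w; rewrite comp_lfunE !tmapE !comp_lfunE. Qed.

Lemma tmap_bilin V W V' W' : bilin (@tmap V W V' W').
Proof.
split=> h a f g; apply: tens_ext => v w;
rewrite add_lfunE scale_lfunE !tmapE add_lfunE scale_lfunE.
  by rewrite (tensv_bilin _ _).1.
by rewrite (tensv_bilin _ _).2.
Qed.

Lemma tassoc_nat V W U V' W' U' (f : 'Hom(V, V')) (g : 'Hom(W, W')) (h : 'Hom(U, U')) :
  (tassoc V' W' U' \o tmap (tmap f g) h = tmap f (tmap g h) \o tassoc V W U)%VF.
Proof.
by apply: tens_ext3l => v w u; rewrite !comp_lfunE !(tmapE, tassocE).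
Qed.

Lemma tassocK V W U : (tassoci V W U \o tassoc V W U = \1)%VF.
Proof. by apply: tens_ext3l => v w u; rewrite comp_lfunE tassocE tassociE id_lfunE. Qed.

Lemma tassociK V W U : (tassoc V W U \o tassoci V W U = \1)%VF.
Proof. by apply: tens_ext3r => v w u; rewrite comp_lfunE tassociE tassocE id_lfunE. Qed.

Lemma tlunit_nat V W (f : 'Hom(V, W)) :
  (tlunit W \o tmap \1 f = f \o tlunit V)%VF.
Proof.
by apply: tens_ext => a v; rewrite !comp_lfunE tmapE !tlunitE id_lfunE linearZ.
Qed.

Lemma trunit_nat V W (f : 'Hom(V, W)) :
  (trunit W \o tmap f \1 = f \o trunit V)%VF.
Proof.
by apply: tens_ext => v a; rewrite !comp_lfunE tmapE !trunitE id_lfunE linearZ.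
Qed.

Lemma tlunitK V : (tluniti V \o tlunit V = \1)%VF.
Proof.
apply: tens_ext => a v; rewrite comp_lfunE tlunitE tlunitiE id_lfunE.
rewrite (bilinZr (tensv_bilin _ _)) -(bilinZl (tensv_bilin _ _)).
by congr tensv; rewrite /GRing.scale /= mulr1.
Qed.

Lemma tlunitiK V : (tlunit V \o tluniti V = \1)%VF.
Proof. by apply/lfunP => v; rewrite comp_lfunE tlunitiE tlunitE id_lfunE scale1r. Qed.

Lemma trunitK V : (truniti V \o trunit V = \1)%VF.
Proof.
apply: tens_ext => v a; rewrite comp_lfunE trunitE trunitiE id_lfunE.
rewrite (bilinZl (tensv_bilin _ _)) -(bilinZr (tensv_bilin _ _)).
by congr tensv; rewrite /GRing.scale /= mulr1.
Qed.

Lemma trunitiK V : (trunit V \o truniti V = \1)%VF.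
Proof. by apply/lfunP => v; rewrite comp_lfunE trunitiE trunitE id_lfunE scale1r. Qed.

Lemma tpentagon V W U Z :
  (tassoc V W (tensV U Z) \o tassoc (tensV V W) U Z =
   tmap \1 (tassoc W U Z) \o (tassoc V (tensV W U) Z \o tmap (tassoc V W U) \1))%VF.
Proof.
apply: tens_ext4 => v w u z.
by rewrite !comp_lfunE !(tmapE, tassocE, id_lfunE).
Qed.

Lemma ttriangle V W :
  (tmap \1 (tlunit W) \o tassoc V k^o W = tmap (trunit V) \1)%VF.
Proof.
apply: tens_ext3l => v a w.
rewrite comp_lfunE tassocE !tmapE !id_lfunE tlunitE trunitE.
by rewrite (bilinZr (tensv_bilin _ _)) (bilinZl (tensv_bilin _ _)).
Qed.

End TensorProduct.

Declare Scope cat_scope.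
Delimit Scope cat_scope with cat.

(* Categories, functors and tensor products are k-linear throughout. *)
Record lincat (k : fieldType) := LinCat {
  ob :> Type;
  mor : ob -> ob -> lmodType k;
  idm : forall x, mor x x;
  cmp : forall x y z, mor y z -> mor x y -> mor x z;
  cmp1m : forall x y (f : mor x y), cmp (idm y) f = f;
  cmpm1 : forall x y (f : mor x y), cmp f (idm x) = f;
  cmpA : forall x y z t (h : mor z t) (g : mor y z) (f : mor x y),
    cmp h (cmp g f) = cmp (cmp h g) f;
  cmp_bilin : forall x y z, bilin (@cmp x y z) }.

Arguments mor {k C} x y : rename.
Arguments idm {k C} x : rename.
Arguments cmp {k C x y z} g f : rename.
Notation "g \c f" := (cmp g f) (at level 50, left associativity) : cat_scope.
Local Open Scope cat_scope.

Definition mutual_inverse k (C : lincat k) (x y : C) (f : mor x y) (g : mor y x) :=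
  g \c f = idm x /\ f \c g = idm y.

Definition is_iso k (C : lincat k) (x y : C) (f : mor x y) :=
  exists g : mor y x, mutual_inverse f g.

Record functor k (C D : lincat k) := Functor {
  fob :> C -> D;
  fmor : forall x y, mor x y -> mor (fob x) (fob y);
  fmor_linear : forall x y, linear (@fmor x y);
  fmor1 : forall x, fmor (idm x) = idm (fob x);
  fmorM : forall x y z (g : mor y z) (f : mor x y),
    fmor (g \c f) = fmor g \c fmor f }.

Arguments fmor {k C D} F {x y} f : rename.

Definition id_functor k (C : lincat k) : functor C C :=
  @Functor k C C (fun x => x) (fun x y f => f) (fun x y a f g => erefl)
    (fun x => erefl) (fun x y z g f => erefl).

Section CompFunctor.
Variables (k : fieldType) (C D E : lincat k) (G : functor D E) (F : functor C D).

Fact comp_fmor_linear x y : linear (fun f : mor x y => fmor G (fmor F f)).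
Proof. by move=> a f g; rewrite !fmor_linear. Qed.

Fact comp_fmor1 x : fmor G (fmor F (idm x)) = idm (G (F x)).
Proof. by rewrite !fmor1. Qed.

Fact comp_fmorM x y z (g : mor y z) (f : mor x y) :
  fmor G (fmor F (g \c f)) = fmor G (fmor F g) \c fmor G (fmor F f).
Proof. by rewrite !fmorM. Qed.

Definition comp_functor : functor C E :=
  @Functor k C E (fun x => G (F x)) (fun x y f => fmor G (fmor F f))
    comp_fmor_linear comp_fmor1 comp_fmorM.

End CompFunctor.

Definition naturally_iso k (C D : lincat k) (F G : functor C D) : Prop :=
  exists eta : forall x, mor (F x) (G x),
    (forall x, is_iso (eta x)) /\
    (forall x y (f : mor x y), eta y \c fmor F f = fmor G f \c eta x).

Definition is_equivalence k (C D : lincat k) (F : functor C D) : Prop :=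
  exists G : functor D C,
    naturally_iso (comp_functor G F) (id_functor C) /\
    naturally_iso (comp_functor F G) (id_functor D).

Record tencat (k : fieldType) := TenCat {
  tcat :> lincat k;
  tone : tcat;
  tob : tcat -> tcat -> tcat;
  tmor : forall x x' y y' : tcat, mor x x' -> mor y y' -> mor (tob x y) (tob x' y');
  tmor_bilin : forall x x' y y', bilin (@tmor x x' y y');
  tmor1 : forall x y, tmor (idm x) (idm y) = idm (tob x y);
  tmorM : forall x x' x'' y y' y'' (f' : mor x' x'') (f : mor x x')
      (g' : mor y' y'') (g : mor y y'),
    tmor (f' \c f) (g' \c g) = tmor f' g' \c tmor f g;
  assoc : forall x y z, mor (tob (tob x y) z) (tob x (tob y z));
  associ : forall x y z, mor (tob x (tob y z)) (tob (tob x y) z);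
  assocK : forall x y z, mutual_inverse (assoc x y z) (associ x y z);
  assoc_nat : forall x x' y y' z z' (f : mor x x') (g : mor y y') (h : mor z z'),
    assoc x' y' z' \c tmor (tmor f g) h = tmor f (tmor g h) \c assoc x y z;
  lunit : forall x, mor (tob tone x) x;
  lunit_iso : forall x, is_iso (lunit x);
  lunit_nat : forall x y (f : mor x y), lunit y \c tmor (idm tone) f = f \c lunit x;
  runit : forall x, mor (tob x tone) x;
  runit_iso : forall x, is_iso (runit x);
  runit_nat : forall x y (f : mor x y), runit y \c tmor f (idm tone) = f \c runit x;
  pentagon : forall x y z t,
    assoc x y (tob z t) \c assoc (tob x y) z t =
    tmor (idm x) (assoc y z t) \c (assoc x (tob y z) t \c tmor (assoc x y z) (idm t));
  triangle : forall x y,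
    tmor (idm x) (lunit y) \c assoc x tone y = tmor (runit x) (idm y) }.

Arguments tone {k C} : rename.
Arguments tob {k C} x y : rename.
Arguments tmor {k C x x' y y'} f g : rename.
Arguments assoc {k C} x y z : rename.
Arguments associ {k C} x y z : rename.
Arguments lunit {k C} x : rename.
Arguments runit {k C} x : rename.
Notation "x \ox y" := (tob x y) (at level 40, left associativity) : cat_scope.
Notation "f \om g" := (tmor f g) (at level 40, left associativity) : cat_scope.

Record tensor_functor k (C D : tencat k) := TensorFunctor {
  tfun :> functor C D;
  tfun2 : forall x y, mor (tfun x \ox tfun y) (tfun (x \ox y));
  tfun0 : mor tone (tfun tone);
  tfun2_iso : forall x y, is_iso (tfun2 x y);
  tfun0_iso : is_iso tfun0;
  tfun2_nat : forall x x' y y' (f : mor x x') (g : mor y y'),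
    tfun2 x' y' \c (fmor tfun f \om fmor tfun g) = fmor tfun (f \om g) \c tfun2 x y;
  tfun_assoc : forall x y z,
    fmor tfun (assoc x y z) \c (tfun2 (x \ox y) z \c (tfun2 x y \om idm (tfun z))) =
    tfun2 x (y \ox z) \c ((idm (tfun x) \om tfun2 y z) \c assoc (tfun x) (tfun y) (tfun z));
  tfun_lunit : forall x,
    fmor tfun (lunit x) \c (tfun2 tone x \c (tfun0 \om idm (tfun x))) = lunit (tfun x);
  tfun_runit : forall x,
    fmor tfun (runit x) \c (tfun2 x tone \c (idm (tfun x) \om tfun0)) = runit (tfun x) }.

(* Strong monoidal k-linear functor that is an equivalence of categories. *)
Definition tensor_equivalent k (C D : tencat k) : Prop :=
  exists F : tensor_functor C D, is_equivalence F.

Record braided_tencat (k : fieldType) := BraidedTenCat {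
  btcat :> tencat k;
  braid : forall x y : btcat, mor (x \ox y) (y \ox x);
  braid_iso : forall x y, is_iso (braid x y);
  braid_nat : forall x x' y y' (f : mor x x') (g : mor y y'),
    braid x' y' \c (f \om g) = (g \om f) \c braid x y;
  hexagonr : forall x y z,
    assoc y z x \c (braid x (y \ox z) \c assoc x y z) =
    (idm y \om braid x z) \c (assoc y x z \c (braid x y \om idm z));
  hexagonl : forall x y z,
    associ z x y \c (braid (x \ox y) z \c associ x y z) =
    (braid x z \om idm y) \c (associ x z y \c (idm x \om braid y z)) }.

Arguments braid {k C} x y : rename.

Definition transparent k (C : braided_tencat k) (x : C) : Prop :=
  forall y : C, mutual_inverse (braid x y) (braid y x).

Section FullSubcategory.
Variables (k : fieldType) (C : tencat k) (P : C -> Prop).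
Hypothesis (P1 : P tone) (PM : forall x y, P x -> P y -> P (x \ox y)).

Definition full_lincat : lincat k :=
  @LinCat k {x : C | P x} (fun x y => mor (sval x) (sval y))
    (fun x => idm (sval x)) (fun x y z g f => g \c f)
    (fun x y f => cmp1m f) (fun x y f => cmpm1 f)
    (fun x y z t h g f => cmpA h g f)
    (fun x y z => cmp_bilin (sval x) (sval y) (sval z)).

Definition full_tencat : tencat k :=
  @TenCat k full_lincat (exist P tone P1)
    (fun x y => exist P (sval x \ox sval y) (PM (svalP x) (svalP y)))
    (fun x x' y y' f g => tmor f g)
    (fun x x' y y' => @tmor_bilin k C (sval x) (sval x') (sval y) (sval y'))
    (fun x y => tmor1 (sval x) (sval y))
    (fun x x' x'' y y' y'' f' f g' g => tmorM f' f g' g)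
    (fun x y z => assoc (sval x) (sval y) (sval z))
    (fun x y z => associ (sval x) (sval y) (sval z))
    (fun x y z => assocK (sval x) (sval y) (sval z))
    (fun x x' y y' z z' f g h => assoc_nat f g h)
    (fun x => lunit (sval x)) (fun x => lunit_iso (sval x))
    (fun x y f => lunit_nat f)
    (fun x => runit (sval x)) (fun x => runit_iso (sval x))
    (fun x y f => runit_nat f)
    (fun x y z t => pentagon (sval x) (sval y) (sval z) (sval t))
    (fun x y => triangle (sval x) (sval y)).

End FullSubcategory.

Section Transparent.
Variables (k : fieldType) (C : braided_tencat k).

Lemma inv_cmp (x y z : C) (f : mor x y) (f' : mor y x) (g : mor y z) (g' : mor z y) :
  mutual_inverse f f' -> mutual_inverse g g' -> mutual_inverse (g \c f) (f' \c g').
Proof.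
move=> [f1 f2] [g1 g2]; split.
  by rewrite cmpA -[X in X \c f]cmpA g1 cmpm1.
by rewrite cmpA -[X in X \c g']cmpA f2 cmpm1.
Qed.

Lemma inv_sym (x y : C) (f : mor x y) (f' : mor y x) :
  mutual_inverse f f' -> mutual_inverse f' f.
Proof. by case. Qed.

Lemma inv_1tens (x y z : C) (f : mor x y) (f' : mor y x) :
  mutual_inverse f f' -> mutual_inverse (idm z \om f) (idm z \om f').
Proof. by move=> [f1 f2]; split; rewrite -tmorM cmp1m ?f1 ?f2 tmor1. Qed.

Lemma inv_tens1 (x y z : C) (f : mor x y) (f' : mor y x) :
  mutual_inverse f f' -> mutual_inverse (f \om idm z) (f' \om idm z).
Proof. by move=> [f1 f2]; split; rewrite -tmorM cmp1m ?f1 ?f2 tmor1. Qed.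

Lemma transparent_tens (x y : C) :
  transparent x -> transparent y -> transparent (x \ox y).
Proof.
move=> tx ty z.
have El : braid (x \ox y) z = assoc z x y \c
   ((braid x z \om idm y) \c (associ x z y \c (idm x \om braid y z)) \c assoc x y z).
  rewrite -hexagonl !cmpA (assocK z x y).2 cmp1m -cmpA.
  by rewrite (assocK x y z).1 cmpm1.
have Er : braid z (x \ox y) = associ x y z \c
   ((idm x \om braid z y) \c (assoc x z y \c (braid z x \om idm y)) \c associ z x y).
  rewrite -hexagonr !cmpA (assocK x y z).1 cmp1m -cmpA.
  by rewrite (assocK z x y).2 cmpm1.
have -> : braid z (x \ox y) = (associ x y z \c
   (((idm x \om braid z y) \c assoc x z y) \c (braid z x \om idm y))) \c associ z x y.
  by rewrite Er !cmpA.
have -> : braid (x \ox y) z = assoc z x y \c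
   (((braid x z \om idm y) \c (associ x z y \c (idm x \om braid y z))) \c assoc x y z).
  by rewrite El !cmpA.
apply: inv_cmp (assocK z x y).
apply: inv_cmp (assocK x y z) _.
apply: inv_cmp; last exact/inv_tens1/tx.
by apply: inv_cmp; [exact/inv_1tens/ty | exact/inv_sym/assocK].
Qed.

End Transparent.

Section Rep.
Variables (k : fieldType) (G : groupType).

Record rep := Rep {
  rsp :> vectType k;
  rop : G -> 'End(rsp);
  rop1 : rop 1%g = \1%VF;
  ropM : forall g h, rop (g * h)%g = (rop g \o rop h)%VF }.

Definition is_rep_hom (V W : rep) : {pred 'Hom(V, W)} :=
  fun f => `[< forall g, (f \o rop V g = rop W g \o f)%VF >].

Arguments is_rep_hom : clear implicits.

Fact is_rep_hom_closed V W : subsemimod_closed (is_rep_hom V W).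
Proof.
split; first split.
- by apply/asboolP => g; rewrite comp_lfun0l comp_lfun0r.
- move=> f h /asboolP Hf /asboolP Hh; apply/asboolP => g.
  by rewrite comp_lfunDl comp_lfunDr Hf Hh.
- move=> a f /asboolP Hf; apply/asboolP => g.
  by rewrite -comp_lfunZl -comp_lfunZr Hf.
Qed.

HB.instance Definition _ (V W : rep) :=
  GRing.isSubmodClosed.Build k 'Hom(V, W) (is_rep_hom V W) (is_rep_hom_closed V W).

Record rep_hom (V W : rep) := RepHom {
  rep_hom_val :> 'Hom(V, W);
  _ : rep_hom_val \in is_rep_hom V W }.

HB.instance Definition _ (V W : rep) := [isSub of rep_hom V W for @rep_hom_val V W].
HB.instance Definition _ (V W : rep) := [Choice of rep_hom V W by <:].
HB.instance Definition _ (V W : rep) := [SubChoice_isSubLmodule of rep_hom V W by <:].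

Lemma rep_homE V W (f : rep_hom V W) g : (f \o rop V g = rop W g \o f)%VF.
Proof. by case: f => f /= /asboolP. Qed.

Definition mkrep_hom (V W : rep) (f : 'Hom(V, W))
    (H : forall g, (f \o rop V g = rop W g \o f)%VF) : rep_hom V W :=
  RepHom (asboolT H).

Arguments mkrep_hom : clear implicits.

Lemma rep_hom_inj V W (f g : rep_hom V W) : f = g :> 'Hom(V, W) -> f = g.
Proof. exact: val_inj. Qed.

Definition rep_id V : rep_hom V V :=
  mkrep_hom V V _ (fun g => etrans (comp_lfun1l _) (esym (comp_lfun1r _))).

Fact rep_cmp_subproof V W U (f : rep_hom W U) (h : rep_hom V W) g :
  ((f \o h) \o rop V g = rop U g \o (f \o h))%VF.
Proof. by rewrite -comp_lfunA rep_homE !comp_lfunA rep_homE. Qed.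

Definition rep_cmp V W U (f : rep_hom W U) (h : rep_hom V W) : rep_hom V U := mkrep_hom V U _ (@rep_cmp_subproof V W U f h).

Fact rep_cmp1m V W (f : rep_hom V W) : rep_cmp (rep_id W) f = f.
Proof. by apply: rep_hom_inj; rewrite /= comp_lfun1l. Qed.
Fact rep_cmpm1 V W (f : rep_hom V W) : rep_cmp f (rep_id V) = f.
Proof. by apply: rep_hom_inj; rewrite /= comp_lfun1r. Qed.
Fact rep_cmpA V W U Z (h : rep_hom U Z) (g : rep_hom W U) (f : rep_hom V W) :
  rep_cmp h (rep_cmp g f) = rep_cmp (rep_cmp h g) f.
Proof. by apply: rep_hom_inj; rewrite /= comp_lfunA. Qed.
Fact rep_cmp_bilin V W U : bilin (@rep_cmp V W U).
Proof.
split=> h a f g; apply: rep_hom_inj => /=.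
  by rewrite comp_lfunDl comp_lfunZl.
by rewrite comp_lfunDr comp_lfunZr.
Qed.

Definition rep_lincat : lincat k :=
  @LinCat k rep rep_hom rep_id rep_cmp rep_cmp1m rep_cmpm1 rep_cmpA rep_cmp_bilin.

Fact rep_tens1 (V W : rep) : tmap (rop V 1%g) (rop W 1%g) = \1%VF.
Proof. by rewrite !rop1 tmap1. Qed.
Fact rep_tensM (V W : rep) g h :
  tmap (rop V (g * h)%g) (rop W (g * h)%g) =
  (tmap (rop V g) (rop W g) \o tmap (rop V h) (rop W h))%VF.
Proof. by rewrite !ropM tmap_comp. Qed.

Definition rep_tens (V W : rep) : rep :=
  @Rep (tensV V W) (fun g => tmap (rop V g) (rop W g))
    (rep_tens1 V W) (rep_tensM V W).

Definition rep_one : rep :=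
  @Rep k^o (fun=> \1%VF) erefl (fun _ _ => esym (comp_lfun1l _)).

Fact rep_tmor_subproof V V' W W' (f : rep_hom V V') (h : rep_hom W W') g :
  (tmap f h \o rop (rep_tens V W) g = rop (rep_tens V' W') g \o tmap f h)%VF.
Proof. by rewrite /= -!tmap_comp !rep_homE. Qed.
Definition rep_tmor V V' W W' (f : rep_hom V V') (h : rep_hom W W') : rep_hom (rep_tens V W) (rep_tens V' W') :=
  mkrep_hom (rep_tens V W) (rep_tens V' W') (tmap f h) (@rep_tmor_subproof V V' W W' f h).

Fact rep_tmor_bilin V V' W W' : bilin (@rep_tmor V V' W W').
Proof. by split=> h a f g; apply: rep_hom_inj; rewrite /= ?(tmap_bilin _ _ _ _).1 ?(tmap_bilin _ _ _ _).2. Qed.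
Fact rep_tmor1 V W : rep_tmor (rep_id V) (rep_id W) = rep_id (rep_tens V W).
Proof. by apply: rep_hom_inj; rewrite /= tmap1. Qed.
Fact rep_tmorM V V' V'' W W' W'' (f' : rep_hom V' V'') (f : rep_hom V V')
    (g' : rep_hom W' W'') (g : rep_hom W W') :
  rep_tmor (rep_cmp f' f) (rep_cmp g' g) = rep_cmp (rep_tmor f' g') (rep_tmor f g).
Proof. by apply: rep_hom_inj; rewrite /= tmap_comp. Qed.

Lemma inv_intertw (V W : vectType k) (A : 'End(V)) (B : 'End(W))
    (f : 'Hom(V, W)) (h : 'Hom(W, V)) :
  (h \o f = \1)%VF -> (f \o h = \1)%VF ->
  (f \o A = B \o f)%VF -> (h \o B = A \o h)%VF.
Proof.
move=> hf fh fA; rewrite -[LHS]comp_lfun1r -fh !comp_lfunA.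
by rewrite -[(h \o B \o f)%VF]comp_lfunA -fA !comp_lfunA hf comp_lfun1l.
Qed.

Definition rep_assoc (V W U : rep) :
  rep_hom (rep_tens (rep_tens V W) U) (rep_tens V (rep_tens W U)) :=
  mkrep_hom (rep_tens (rep_tens V W) U) (rep_tens V (rep_tens W U)) (tassoc V W U)
    (fun g => tassoc_nat (rop V g) (rop W g) (rop U g)).
Definition rep_associ (V W U : rep) :
  rep_hom (rep_tens V (rep_tens W U)) (rep_tens (rep_tens V W) U) :=
  mkrep_hom (rep_tens V (rep_tens W U)) (rep_tens (rep_tens V W) U) (tassoci V W U)
    (fun g => inv_intertw (tassocK V W U) (tassociK V W U)
                        (rep_homE (rep_assoc V W U) g)).
Fact rep_assocK (V W U : rep) :
  @mutual_inverse k rep_lincat _ _ (rep_assoc V W U) (rep_associ V W U).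
Proof. by split; apply: rep_hom_inj; [exact: tassocK | exact: tassociK]. Qed.
Fact rep_assoc_nat V V' W W' U U' (f : rep_hom V V') (g : rep_hom W W')
    (h : rep_hom U U') :
  rep_cmp (rep_assoc V' W' U') (rep_tmor (rep_tmor f g) h) =
  rep_cmp (rep_tmor f (rep_tmor g h)) (rep_assoc V W U).
Proof. by apply: rep_hom_inj; exact: tassoc_nat. Qed.

Definition rep_lunit (V : rep) : rep_hom (rep_tens rep_one V) V :=
  mkrep_hom (rep_tens rep_one V) V (tlunit V) (fun g => tlunit_nat (rop V g)).
Definition rep_runit (V : rep) : rep_hom (rep_tens V rep_one) V :=
  mkrep_hom (rep_tens V rep_one) V (trunit V) (fun g => trunit_nat (rop V g)).
Fact rep_lunit_iso V : @is_iso k rep_lincat _ _ (rep_lunit V).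
Proof.
exists (mkrep_hom V (rep_tens rep_one V) (tluniti V) (fun g => inv_intertw (tlunitK V) (tlunitiK V)
                              (rep_homE (rep_lunit V) g))).
by split; apply: rep_hom_inj; [exact: tlunitK | exact: tlunitiK].
Qed.
Fact rep_runit_iso V : @is_iso k rep_lincat _ _ (rep_runit V).
Proof.
exists (mkrep_hom V (rep_tens V rep_one) (truniti V) (fun g => inv_intertw (trunitK V) (trunitiK V)
                              (rep_homE (rep_runit V) g))).
by split; apply: rep_hom_inj; [exact: trunitK | exact: trunitiK].
Qed.
Fact rep_lunit_nat V W (f : rep_hom V W) :
  rep_cmp (rep_lunit W) (rep_tmor (rep_id rep_one) f) = rep_cmp f (rep_lunit V).
Proof. by apply: rep_hom_inj; exact: tlunit_nat. Qed.
Fact rep_runit_nat V W (f : rep_hom V W) :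
  rep_cmp (rep_runit W) (rep_tmor f (rep_id rep_one)) = rep_cmp f (rep_runit V).
Proof. by apply: rep_hom_inj; exact: trunit_nat. Qed.
Fact rep_pentagon V W U Z :
  rep_cmp (rep_assoc V W (rep_tens U Z)) (rep_assoc (rep_tens V W) U Z) =
  rep_cmp (rep_tmor (rep_id V) (rep_assoc W U Z))
    (rep_cmp (rep_assoc V (rep_tens W U) Z) (rep_tmor (rep_assoc V W U) (rep_id Z))).
Proof. by apply: rep_hom_inj; exact: tpentagon. Qed.
Fact rep_triangle V W :
  rep_cmp (rep_tmor (rep_id V) (rep_lunit W)) (rep_assoc V rep_one W) =
  rep_tmor (rep_runit V) (rep_id W).
Proof. by apply: rep_hom_inj; exact: ttriangle. Qed.

Definition rep_tencat : tencat k :=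
  @TenCat k rep_lincat rep_one rep_tens rep_tmor rep_tmor_bilin rep_tmor1 rep_tmorM
    rep_assoc rep_associ rep_assocK rep_assoc_nat
    rep_lunit rep_lunit_iso rep_lunit_nat
    rep_runit rep_runit_iso rep_runit_nat rep_pentagon rep_triangle.

End Rep.

(* [cm_act X m g] is m^g (MathComp actions are right actions) and the
   library's [x ^ y] is the conjugate y^-1 * (x * y). *)
Record crossed_module := CrossedModule {
  cm1 : finGroupType;
  cm2 : finGroupType;
  cm_act : groupAction [set: cm1] [set: cm2];
  cm_bd : {morphism [set: cm2] >-> cm1};
  cm_equiv : forall (m : cm2) (g : cm1), cm_bd (cm_act m g) = (cm_bd m ^ g)%g;
  cm_peiffer : forall m n : cm2, cm_act m (cm_bd n) = (m ^ n)%g }.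

Section CrossedModuleTheory.
Variable X : crossed_module.
Implicit Types (m n : cm2 X) (g h : cm1 X).

Lemma cm_bdM m n : cm_bd X (m * n)%g = (cm_bd X m * cm_bd X n)%g.
Proof. exact: morphM (in_setT _) (in_setT _). Qed.
Lemma cm_bd1 : cm_bd X 1%g = 1%g. Proof. exact: morph1. Qed.
Lemma cm_bdV m : cm_bd X m^-1%g = (cm_bd X m)^-1%g.
Proof. exact: morphV (in_setT _). Qed.
Lemma cm_actM m g h : cm_act X m (g * h)%g = cm_act X (cm_act X m g) h.
Proof. by rewrite actMin ?in_setT. Qed.
Lemma cm_act1 m : cm_act X m 1%g = m. Proof. exact: act1. Qed.
Lemma cm_actMl m n g : cm_act X (m * n)%g g = (cm_act X m g * cm_act X n g)%g.
Proof. exact: gactM (in_setT _) _ _ (in_setT _) (in_setT _). Qed.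
Lemma cm_actK m g : cm_act X (cm_act X m g^-1%g) g = m.
Proof. by rewrite -cm_actM mulVg cm_act1. Qed.
Lemma cm_actKV m g : cm_act X (cm_act X m g) g^-1%g = m.
Proof. by rewrite -cm_actM mulgV cm_act1. Qed.
Lemma cm_act1l g : cm_act X 1%g g = 1%g.
Proof. by apply: (mulgI (cm_act X 1%g g)); rewrite -cm_actMl !mulg1. Qed.

Definition cm_ker : {group cm2 X} := ('ker (cm_bd X))%g.
Definition cm_im : {group cm1 X} := (cm_bd X @* [set: cm2 X])%g.
Definition cm_coker : finGroupType := coset_of cm_im.

Lemma cm_kerP m : reflect (cm_bd X m = 1%g) (m \in cm_ker).
Proof. by apply: (iffP idP) => [/mker|bm]; rewrite ?inE /= ?bm ?in_setT ?set11. Qed.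

Lemma cm_ker_act m g : m \in cm_ker -> cm_act X m g \in cm_ker.
Proof. by move=> /cm_kerP bm; apply/cm_kerP; rewrite cm_equiv bm conj1g. Qed.

Lemma cm_im_norm g : g \in 'N(cm_im)%g.
Proof.
apply/normP/eqP; rewrite eqEcard cardJg leqnn andbT.
apply/subsetP => _ /imsetP[x /morphimP[m _ _ ->] ->].
by rewrite -cm_equiv mem_morphim ?in_setT.
Qed.

Lemma cm_im_act_ker m g : m \in cm_ker -> g \in cm_im -> cm_act X m g = m.
Proof.
move=> /cm_kerP bm /morphimP[n _ _ ->]; rewrite cm_peiffer.
apply/conjg_fixP; apply/commgP; apply: commute_sym.
by apply/commgP; apply/conjg_fixP; rewrite -cm_peiffer bm cm_act1.
Qed.

(* The action of coker on ker; [cm_kactE] is the defining k^{Ig} = k^g. *)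
Definition cm_kact (x : [subg cm_ker]) (c : cm_coker) : [subg cm_ker] :=
  subg cm_ker (cm_act X (sgval x) (repr c)).

Lemma cm_kactE x g : sgval (cm_kact x (coset cm_im g)) = cm_act X (sgval x) g.
Proof.
rewrite /cm_kact subgK ?cm_ker_act ?subgP //.
rewrite val_coset ?cm_im_norm //.
have := mem_repr_rcoset cm_im g; case/rcosetP=> i iI ->.
by rewrite cm_actM (cm_im_act_ker (subgP x) iI).
Qed.

Lemma cm_coker_ind (P : cm_coker -> Prop) : (forall g, P (coset cm_im g)) -> forall c, P c.
Proof. by move=> H c; rewrite -(coset_reprK c). Qed.

Lemma cm_cosetM g h : (coset cm_im g * coset cm_im h)%g = coset cm_im (g * h)%g.
Proof. by rewrite morphM ?cm_im_norm. Qed.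

Lemma cm_cosetV g : ((coset cm_im g)^-1)%g = coset cm_im g^-1%g.
Proof. by rewrite morphV ?cm_im_norm. Qed.

Lemma cm_kactM x c d : cm_kact x (c * d)%g = cm_kact (cm_kact x c) d.
Proof.
elim/cm_coker_ind: c => g; elim/cm_coker_ind: d => h.
by apply: subg_inj; rewrite cm_cosetM !cm_kactE cm_actM.
Qed.

Lemma cm_kact1 x : cm_kact x 1%g = x.
Proof. by apply: subg_inj; rewrite -(coset_id (group1 cm_im)) cm_kactE cm_act1. Qed.

Lemma cm_kactMl x y c : cm_kact (x * y)%g c = (cm_kact x c * cm_kact y c)%g.
Proof.
elim/cm_coker_ind: c => g; apply: subg_inj.
by rewrite sgvalM ?in_setT // !cm_kactE sgvalM ?in_setT // cm_actMl.
Qed.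

Lemma cm_kact1l c : cm_kact 1%g c = 1%g.
Proof. by apply: (mulgI (cm_kact 1%g c)); rewrite -cm_kactMl !mulg1. Qed.

End CrossedModuleTheory.

Section GroupG.
Variables (k : fieldType) (X : crossed_module).
Local Notation K := [subg cm_ker X].

(* A character is determined by its values in k; they lie in k^* because
   chi 1 = 1 and chi is multiplicative. *)
Definition is_char (chi : {ffun K -> k}) : bool :=
  (chi 1%g == 1) && [forall x, forall y, chi (x * y)%g == chi x * chi y].

Lemma is_charP (chi : {ffun K -> k}) :
  reflect (chi 1%g = 1 /\ forall x y, chi (x * y)%g = chi x * chi y) (is_char chi).
Proof.
apply: (iffP andP) => [[/eqP ? /forallP H]|[-> H]].
  by split=> // x y; apply/eqP; move/forallP: (H x).
by rewrite eqxx; split=> //; apply/forallP => x; apply/forallP => y; rewrite H.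
Qed.

Record kchar := Kchar { kchar_val :> {ffun K -> k}; _ : is_char kchar_val }.
HB.instance Definition _ := [isSub for kchar_val].
HB.instance Definition _ := [Choice of kchar by <:].

Lemma kcharM (chi : kchar) x y : chi (x * y)%g = chi x * chi y.
Proof. by case: chi => f /= /is_charP[]. Qed.
Lemma kchar1 (chi : kchar) : chi 1%g = 1.
Proof. by case: chi => f /= /is_charP[]. Qed.

Lemma kchar_inj (chi psi : kchar) : chi =1 psi -> chi = psi.
Proof. by move=> E; apply: val_inj; apply/ffunP. Qed.

Fact kchar_one_subproof : is_char [ffun=> 1].
Proof. by apply/is_charP; split=> *; rewrite !ffunE ?mulr1. Qed.
Fact kchar_mul_subproof (chi psi : kchar) : is_char [ffun x => chi x * psi x].
Proof. by apply/is_charP; split=> *; rewrite !ffunE ?kchar1 ?mulr1 // !kcharM mulrACA. Qed.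
Fact kchar_inv_subproof (chi : kchar) : is_char [ffun x => (chi x)^-1].
Proof. by apply/is_charP; split=> *; rewrite !ffunE ?kchar1 ?invr1 // kcharM invfM. Qed.

Definition kchar_one := Kchar kchar_one_subproof.
Definition kchar_mul chi psi := Kchar (kchar_mul_subproof chi psi).
Definition kchar_inv chi := Kchar (kchar_inv_subproof chi).

Lemma kchar_neq0 (chi : kchar) x : chi x != 0.
Proof.
apply/eqP => c0; have := oner_neq0 k.
by rewrite -(kchar1 chi) -(mulgV x) kcharM c0 mul0r eqxx.
Qed.

Fact kchar_mulA : associative kchar_mul.
Proof. by move=> a b c; apply: kchar_inj => x; rewrite !ffunE mulrA. Qed.
Fact kchar_mulC : commutative kchar_mul.
Proof. by move=> a b; apply: kchar_inj => x; rewrite !ffunE mulrC. Qed.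
Fact kchar_mul1 : left_id kchar_one kchar_mul.
Proof. by move=> a; apply: kchar_inj => x; rewrite !ffunE mul1r. Qed.
Fact kchar_mulr1 : right_id kchar_one kchar_mul.
Proof. by move=> a; rewrite kchar_mulC kchar_mul1. Qed.
Fact kchar_mulV : left_inverse kchar_one kchar_inv kchar_mul.
Proof. by move=> a; apply: kchar_inj => x; rewrite !ffunE mulVf ?kchar_neq0. Qed.
Fact kchar_mulrV : right_inverse kchar_one kchar_inv kchar_mul.
Proof. by move=> a; rewrite kchar_mulC kchar_mulV. Qed.

HB.instance Definition _ := isGroup.Build kchar
  kchar_mulA kchar_mul1 kchar_mulr1 kchar_mulV kchar_mulrV.

Fact kchar_act_subproof (chi : kchar) (c : cm_coker X) :
  is_char [ffun x => chi (cm_kact x c^-1%g)].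
Proof.
apply/is_charP; split=> [|x y]; rewrite !ffunE; first by rewrite cm_kact1l kchar1.
by rewrite cm_kactMl kcharM.
Qed.

Definition kchar_act (chi : kchar) (c : cm_coker X) : kchar :=
  Kchar (kchar_act_subproof chi c).

Lemma kchar_actM chi c d : kchar_act chi (c * d)%g = kchar_act (kchar_act chi c) d.
Proof. by apply: kchar_inj => x; rewrite !ffunE invMg cm_kactM. Qed.
Lemma kchar_act1 chi : kchar_act chi 1%g = chi.
Proof. by apply: kchar_inj => x; rewrite !ffunE invg1 cm_kact1. Qed.
Lemma kchar_actMl chi psi c :
  kchar_act (chi * psi)%g c = (kchar_act chi c * kchar_act psi c)%g.
Proof. by apply: kchar_inj => x; rewrite !ffunE. Qed.
Lemma kchar_act1l c : kchar_act 1%g c = 1%g.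
Proof. by apply: kchar_inj => x; rewrite !ffunE. Qed.

(* The semidirect product.  [kchar * cm_coker] itself carries the direct product,
   hence the separate name. *)
Definition GX : Type := (kchar * cm_coker X)%type.
HB.instance Definition _ := Choice.on GX.

Definition GX_mul (p q : GX) : GX := ((kchar_act p.1 q.2 * q.1)%g, (p.2 * q.2)%g).
Definition GX_one : GX := (1%g, 1%g).
Definition GX_inv (p : GX) : GX := (kchar_act p.1^-1%g p.2^-1%g, p.2^-1%g).

Fact GX_mulA : associative GX_mul.
Proof.
move=> [a1 a2] [b1 b2] [c1 c2]; rewrite /GX_mul /=.
by rewrite kchar_actMl kchar_actM !mulgA.
Qed.
Fact GX_mul1 : left_id GX_one GX_mul.
Proof. by case=> a b; rewrite /GX_mul /= kchar_act1l !mul1g. Qed.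
Fact GX_mulr1 : right_id GX_one GX_mul.
Proof. by case=> a b; rewrite /GX_mul /= kchar_act1 !mulg1. Qed.
Fact GX_mulV : left_inverse GX_one GX_inv GX_mul.
Proof. by case=> a b; rewrite /GX_mul /= -kchar_actM !mulVg kchar_act1 mulVg. Qed.
Fact GX_mulrV : right_inverse GX_one GX_inv GX_mul.
Proof. by case=> a b; rewrite /GX_mul /= -kchar_actMl !mulgV kchar_act1l. Qed.

HB.instance Definition _ := isGroup.Build GX GX_mulA GX_mul1 GX_mulr1 GX_mulV GX_mulrV.

Lemma GX_mulE (p q : GX) : (p * q)%g = (kchar_act p.1 q.2 * q.1, p.2 * q.2)%g.
Proof. by []. Qed.

End GroupG.

Section MX.
Variables (k : fieldType) (X : crossed_module).

(* The grading V = (+)_m V_m is carried by its projections P(m), a complete family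
   of orthogonal idempotents; V_m is recovered as their images [dgrade], and
   [dgrade_direct] gives the direct sum. *)
Record dmod := Dmod {
  dsp :> vectType k;
  dP : cm2 X -> 'End(dsp);
  dQ : cm1 X -> 'End(dsp);
  dPP : forall m n, (dP m \o dP n)%VF = if m == n then dP m else 0;
  dPsum : \sum_m dP m = \1%VF;
  dQ1 : dQ 1%g = \1%VF;
  dQM : forall g h, dQ (g * h)%g = (dQ g \o dQ h)%VF;
  dPQ : forall m g, (dP m \o dQ g)%VF = (dQ g \o dP (cm_act X m g))%VF }.

Implicit Types V W U Z : dmod.

Definition dgrade (V : dmod) (m : cm2 X) : {vspace V} := limg (dP V m).

Lemma dPE V m x : x \in dgrade V m -> dP V m x = x.
Proof. by case/memv_imgP=> y _ ->; rewrite -comp_lfunE dPP eqxx. Qed.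

Lemma dPgrade V m x : dP V m x \in dgrade V m.
Proof. exact/memv_img/memvf. Qed.

Lemma dP_neq V m n x : x \in dgrade V m -> dP V n x = if n == m then x else 0.
Proof.
move=> xm; rewrite -{1}(dPE xm) -comp_lfunE dPP.
by case: eqP => [->|_]; rewrite ?dPE ?zero_lfunE.
Qed.

Lemma dgradeP V m x : reflect (dP V m x = x) (x \in dgrade V m).
Proof. by apply: (iffP idP) => [/dPE|<-] //; exact: dPgrade. Qed.

Lemma dP_sumE V (x : dsp V) : x = \sum_m dP V m x.
Proof. by rewrite -sum_lfunE dPsum id_lfunE. Qed.

Lemma dgrade_direct V :
  directv (\sum_m dgrade V m) /\ (\sum_m dgrade V m)%VS = fullv.
Proof.
split.
  apply/directv_sum_independent => u Hu s0 m _.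
  rewrite -(dPE (Hu m isT)); have := congr1 (dP V m) s0.
  rewrite linear_sum linear0 (bigD1 m) //= big1 ?addr0 // => n nm.
  by rewrite (dP_neq _ (Hu n isT)) eq_sym (negPf nm).
apply/vspaceP => x; rewrite memvf (dP_sumE x); apply: memv_sumr => m _.
exact: dPgrade.
Qed.

Lemma hom_ext V (Y : vectType k) (f g : 'Hom(V, Y)) :
  (forall m (x : dsp V), x \in dgrade V m -> f x = g x) -> f = g.
Proof.
move=> fg; apply/lfunP => x; rewrite (dP_sumE x) !linear_sum.
by apply: eq_bigr => m _ /=; rewrite (fg m) ?dPgrade.
Qed.

Lemma dQgrade V m g x : x \in dgrade V m -> dQ V g x \in dgrade V (cm_act X m g^-1%g).
Proof.
move=> xm; apply/dgradeP; rewrite -comp_lfunE dPQ comp_lfunE cm_actK.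
by rewrite dPE.
Qed.

Definition is_dhom (V W : dmod) : {pred 'Hom(V, W)} :=
  fun f => `[< (forall m, (f @: dgrade V m <= dgrade W m)%VS) /\
               (forall g, (f \o dQ V g = dQ W g \o f)%VF) >].
Arguments is_dhom : clear implicits.

Lemma dgrade_comm V W (f : 'Hom(V, W)) :
  (forall m, (f @: dgrade V m <= dgrade W m)%VS) <->
  (forall m, (f \o dP V m = dP W m \o f)%VF).
Proof.
split=> H m.
  apply: hom_ext => n x xn; rewrite !comp_lfunE (dP_neq _ xn).
  have : f x \in dgrade W n by apply: (subvP (H n)); exact: memv_img.
  by move/dP_neq => ->; case: eqP => // _; rewrite linear0.
apply/subvP => _ /memv_imgP[x xm ->].
by apply/dgradeP; rewrite -comp_lfunE -H comp_lfunE dPE.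
Qed.

Lemma is_dhomP V W (f : 'Hom(V, W)) :
  (f \in is_dhom V W) <-> (forall m, (f \o dP V m = dP W m \o f)%VF) /\
               (forall g, (f \o dQ V g = dQ W g \o f)%VF).
Proof.
by split=> [/asboolP[/dgrade_comm H1 H2]|[/dgrade_comm H1 H2]]; [|apply/asboolP].
Qed.

Fact is_dhom_closed V W : subsemimod_closed (is_dhom V W).
Proof.
split; first split.
- by apply/is_dhomP; split=> ?; rewrite comp_lfun0l comp_lfun0r.
- move=> f h /is_dhomP[Pf Qf] /is_dhomP[Ph Qh]; apply/is_dhomP.
  by split=> ?; rewrite comp_lfunDl comp_lfunDr ?Pf ?Qf ?Ph ?Qh.
- move=> a f /is_dhomP[Pf Qf]; apply/is_dhomP.
  by split=> ?; rewrite -comp_lfunZl -comp_lfunZr ?Pf ?Qf.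
Qed.

HB.instance Definition _ (V W : dmod) :=
  GRing.isSubmodClosed.Build k 'Hom(V, W) (is_dhom V W) (is_dhom_closed V W).

Record dhom (V W : dmod) := Dhom {
  dhom_val :> 'Hom(V, W);
  _ : dhom_val \in is_dhom V W }.

HB.instance Definition _ (V W : dmod) := [isSub of dhom V W for @dhom_val V W].
HB.instance Definition _ (V W : dmod) := [Choice of dhom V W by <:].
HB.instance Definition _ (V W : dmod) := [SubChoice_isSubLmodule of dhom V W by <:].

Lemma dhomPE V W (f : dhom V W) m : (f \o dP V m = dP W m \o f)%VF.
Proof. by case: f => f /= /is_dhomP[]. Qed.
Lemma dhomQE V W (f : dhom V W) g : (f \o dQ V g = dQ W g \o f)%VF.
Proof. by case: f => f /= /is_dhomP[]. Qed.

Definition mkdhom (V W : dmod) (f : 'Hom(V, W))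
    (HP : forall m, (f \o dP V m = dP W m \o f)%VF)
    (HQ : forall g, (f \o dQ V g = dQ W g \o f)%VF) : dhom V W :=
  Dhom ((is_dhomP f).2 (conj HP HQ)).
Arguments mkdhom : clear implicits.

Lemma dhom_inj V W (f g : dhom V W) : f = g :> 'Hom(V, W) -> f = g.
Proof. exact: val_inj. Qed.

Definition mkdhom_inv (V W : dmod) (f : dhom V W) (h : 'Hom(W, V))
    (hf : (h \o f = \1)%VF) (fh : (f \o h = \1)%VF) : dhom W V :=
  mkdhom W V h (fun m => inv_intertw hf fh (dhomPE f m))
               (fun g => inv_intertw hf fh (dhomQE f g)).

Definition dhom_id V : dhom V V :=
  mkdhom V V \1%VF (fun m => etrans (comp_lfun1l _) (esym (comp_lfun1r _)))
                   (fun g => etrans (comp_lfun1l _) (esym (comp_lfun1r _))).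

Fact dhom_cmp_P V W U (f : dhom W U) (h : dhom V W) m :
  ((f \o h) \o dP V m = dP U m \o (f \o h))%VF.
Proof. by rewrite -comp_lfunA dhomPE !comp_lfunA dhomPE. Qed.
Fact dhom_cmp_Q V W U (f : dhom W U) (h : dhom V W) g :
  ((f \o h) \o dQ V g = dQ U g \o (f \o h))%VF.
Proof. by rewrite -comp_lfunA dhomQE !comp_lfunA dhomQE. Qed.
Definition dhom_cmp V W U (f : dhom W U) (h : dhom V W) : dhom V U :=
  mkdhom V U (f \o h)%VF (dhom_cmp_P f h) (dhom_cmp_Q f h).

Fact dhom_cmp1m V W (f : dhom V W) : dhom_cmp (dhom_id W) f = f.
Proof. by apply: dhom_inj; rewrite /= comp_lfun1l. Qed.
Fact dhom_cmpm1 V W (f : dhom V W) : dhom_cmp f (dhom_id V) = f.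
Proof. by apply: dhom_inj; rewrite /= comp_lfun1r. Qed.
Fact dhom_cmpA V W U Z (h : dhom U Z) (g : dhom W U) (f : dhom V W) :
  dhom_cmp h (dhom_cmp g f) = dhom_cmp (dhom_cmp h g) f.
Proof. by apply: dhom_inj; rewrite /= comp_lfunA. Qed.
Fact dhom_cmp_bilin V W U : bilin (@dhom_cmp V W U).
Proof.
split=> h a f g; apply: dhom_inj => /=.
  by rewrite comp_lfunDl comp_lfunZl.
by rewrite comp_lfunDr comp_lfunZr.
Qed.

Definition dmod_lincat : lincat k :=
  @LinCat k dmod dhom dhom_id dhom_cmp dhom_cmp1m dhom_cmpm1 dhom_cmpA dhom_cmp_bilin.

(* (V (x) W)_m = (+)_(n l = m) V_n (x) W_l *)
Definition tensP (V W : dmod) (m : cm2 X) : 'End(tensV V W) :=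
  \sum_(nl : cm2 X * cm2 X | (nl.1 * nl.2)%g == m) tmap (dP V nl.1) (dP W nl.2).
Definition tensQ (V W : dmod) (g : cm1 X) : 'End(tensV V W) :=
  tmap (dQ V g) (dQ W g).

Lemma tensPE V W m a b v w : v \in dgrade V a -> w \in dgrade W b ->
  tensP V W m (tensv v w) = if m == (a * b)%g then tensv v w else 0.
Proof.
move=> va wb; rewrite /tensP sum_lfunE.
transitivity (\sum_(nl : cm2 X * cm2 X | (nl.1 * nl.2)%g == m)
    if nl == (a, b) then tensv v w else 0).
  apply: eq_bigr => -[n l] _ /=; rewrite tmapE (dP_neq _ va) (dP_neq _ wb) xpair_eqE.
  by case: eqP => _; case: eqP => _ //=;
    rewrite ?(bilin0l (tensv_bilin _ _)) ?(bilin0r (tensv_bilin _ _)).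
rewrite -big_mkcondr /= [m == _]eq_sym.
have [E|E] := eqP; last first.
  by apply: big_pred0 => nl /=; apply/negbTE/andP => -[/eqP H /eqP H2]; case: E; rewrite -H H2.
rewrite (big_pred1 (a, b)) // => nl /=.
by case: (nl =P (a, b)) => [->|] /=; rewrite ?E ?eqxx ?andbF.
Qed.

Lemma tens_homext (V W : dmod) (Y : vectType k) (f g : 'Hom(tensV V W, Y)) :
  (forall a b (v : dsp V) (w : dsp W), v \in dgrade V a -> w \in dgrade W b ->
     f (tensv v w) = g (tensv v w)) -> f = g.
Proof.
move=> fg; apply: tens_ext => v w.
rewrite (dP_sumE v) (bilin_suml (tensv_bilin _ _)) !linear_sum.
apply: eq_bigr => a _; rewrite (dP_sumE w) (bilin_sumr (tensv_bilin _ _)) !linear_sum.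
by apply: eq_bigr => b _ /=; rewrite (fg a b) ?dPgrade.
Qed.

Fact tensPP V W m n :
  (tensP V W m \o tensP V W n)%VF = if m == n then tensP V W m else 0.
Proof.
apply: tens_homext => a b v w va wb; rewrite comp_lfunE (tensPE _ va wb).
case: (n =P (a * b)%g) => [->|E].
  rewrite (tensPE _ va wb); case: eqP => [->|_]; rewrite ?zero_lfunE //.
  by rewrite (tensPE _ va wb) eqxx.
rewrite linear0; case: eqP => [->|_]; rewrite ?zero_lfunE //.
by rewrite (tensPE _ va wb); case: eqP.
Qed.

Fact tensPsum V W : \sum_m tensP V W m = \1%VF.
Proof.
apply: tens_homext => a b v w va wb; rewrite sum_lfunE id_lfunE.
rewrite (bigD1 (a * b)%g) //= (tensPE _ va wb) eqxx big1 ?addr0 // => n.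
by rewrite (tensPE _ va wb) => /negPf ->.
Qed.

Fact tensQ1 V W : tensQ V W 1%g = \1%VF.
Proof. by rewrite /tensQ !dQ1 tmap1. Qed.
Fact tensQM V W g h : tensQ V W (g * h)%g = (tensQ V W g \o tensQ V W h)%VF.
Proof. by rewrite /tensQ !dQM tmap_comp. Qed.
Fact tensPQ V W m g :
  (tensP V W m \o tensQ V W g)%VF = (tensQ V W g \o tensP V W (cm_act X m g))%VF.
Proof.
apply: tens_homext => a b v w va wb; rewrite !comp_lfunE tmapE.
rewrite (tensPE _ (dQgrade g va) (dQgrade g wb)) (tensPE _ va wb) -cm_actMl.
have -> : (cm_act X m g == (a * b)%g) = (m == cm_act X (a * b)%g g^-1%g).
  by apply/eqP/eqP => [<-|->]; rewrite ?cm_actKV ?cm_actK.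
by case: eqP; rewrite ?linear0 // tmapE.
Qed.

Definition dtens (V W : dmod) : dmod :=
  @Dmod (tensV V W) (tensP V W) (tensQ V W)
    (tensPP V W) (tensPsum V W) (tensQ1 V W) (tensQM V W) (tensPQ V W).

Definition oneP (m : cm2 X) : 'End(k^o) := if m == 1%g then \1%VF else 0.
Fact onePP m n : (oneP m \o oneP n)%VF = if m == n then oneP m else 0.
Proof.
rewrite /oneP; case: (m =P n) => [->|mn].
  by case: eqP; rewrite ?comp_lfun1l ?comp_lfun0l.
case: eqP => E; case: eqP => E'; rewrite ?comp_lfun0l ?comp_lfun0r //.
by case: mn; rewrite E E'.
Qed.
Fact onePsum : \sum_m oneP m = \1%VF.
Proof.
rewrite (bigD1 1%g) //= big1 ?addr0 => [|m /negPf E]; first by rewrite /oneP eqxx.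
by rewrite /oneP E.
Qed.
Fact onePQ m (g : cm1 X) : (oneP m \o \1)%VF = (\1 \o oneP (cm_act X m g))%VF.
Proof.
rewrite comp_lfun1l comp_lfun1r /oneP; congr (if _ then _ else _).
by apply/eqP/eqP => [->|E]; rewrite ?cm_act1l // -(cm_actKV m g) E cm_act1l.
Qed.
Definition dunit : dmod :=
  @Dmod k^o oneP (fun=> \1%VF) onePP onePsum erefl
    (fun _ _ => esym (comp_lfun1l _)) onePQ.

Lemma dunit_grade (a : k^o) : (a : dunit) \in dgrade dunit 1%g.
Proof. by apply/dgradeP; rewrite /= /oneP eqxx id_lfunE. Qed.

Lemma tens_grade V W a b v w : v \in dgrade V a -> w \in dgrade W b ->
  (tensv v w : dtens V W) \in dgrade (dtens V W) (a * b)%g.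
Proof. by move=> va wb; apply/dgradeP; rewrite /= (tensPE _ va wb) eqxx. Qed.

Lemma dhom_grade V W (f : dhom V W) m x : x \in dgrade V m -> f x \in dgrade W m.
Proof. by move=> xm; apply/dgradeP; rewrite -comp_lfunE -dhomPE comp_lfunE dPE. Qed.

Fact dtmor_P V V' W W' (f : dhom V V') (h : dhom W W') m :
  (tmap f h \o tensP V W m = tensP V' W' m \o tmap f h)%VF.
Proof.
apply: tens_homext => a b v w va wb; rewrite !comp_lfunE tmapE.
rewrite (tensPE _ va wb) (tensPE _ (dhom_grade f va) (dhom_grade h wb)).
by case: eqP; rewrite ?linear0 // tmapE.
Qed.
Fact dtmor_Q V V' W W' (f : dhom V V') (h : dhom W W') g :
  (tmap f h \o tensQ V W g = tensQ V' W' g \o tmap f h)%VF.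
Proof. by rewrite /tensQ -!tmap_comp !dhomQE. Qed.
Definition dtmor V V' W W' (f : dhom V V') (h : dhom W W') :
    dhom (dtens V W) (dtens V' W') :=
  mkdhom (dtens V W) (dtens V' W') (tmap f h) (dtmor_P f h) (dtmor_Q f h).

Fact dtmor_bilin V V' W W' : bilin (@dtmor V V' W W').
Proof.
by split=> h a f g; apply: dhom_inj;
  rewrite /= ?(tmap_bilin _ _ _ _).1 ?(tmap_bilin _ _ _ _).2.
Qed.
Fact dtmor1 V W : dtmor (dhom_id V) (dhom_id W) = dhom_id (dtens V W).
Proof. by apply: dhom_inj; rewrite /= tmap1. Qed.
Fact dtmorM V V' V'' W W' W'' (f' : dhom V' V'') (f : dhom V V')
    (g' : dhom W' W'') (g : dhom W W') :
  dtmor (dhom_cmp f' f) (dhom_cmp g' g) = dhom_cmp (dtmor f' g') (dtmor f g).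
Proof. by apply: dhom_inj; rewrite /= tmap_comp. Qed.

Lemma tens3_homext (V W U : dmod) (Y : vectType k)
    (f g : 'Hom(tensV (tensV V W) U, Y)) :
  (forall a b c (v : dsp V) (w : dsp W) (u : dsp U),
     v \in dgrade V a -> w \in dgrade W b -> u \in dgrade U c ->
     f (tensv (tensv v w) u) = g (tensv (tensv v w) u)) -> f = g.
Proof.
move=> fg; apply: tens_ext => x u; rewrite -tenslE -!comp_lfunE.
congr (fun_of_lfun _ x); apply: tens_homext => a b v w va wb.
rewrite !comp_lfunE tenslE -tensrE -!comp_lfunE.
congr (fun_of_lfun _ u); apply: hom_ext => c y yc.
by rewrite !comp_lfunE tensrE (fg a b c).
Qed.

Fact dassoc_P V W U m :
  (tassoc V W U \o dP (dtens (dtens V W) U) m =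
   dP (dtens V (dtens W U)) m \o tassoc V W U)%VF.
Proof.
apply: tens3_homext => a b c v w u va wb uc; rewrite !comp_lfunE.
rewrite tassocE (dP_neq _ (tens_grade (tens_grade va wb) uc)).
rewrite (dP_neq _ (tens_grade va (tens_grade wb uc))) mulgA.
by case: eqP; rewrite ?linear0 // tassocE.
Qed.
Definition dassoc V W U : dhom (dtens (dtens V W) U) (dtens V (dtens W U)) :=
  mkdhom (dtens (dtens V W) U) (dtens V (dtens W U)) (tassoc V W U)
    (dassoc_P V W U) (fun g => tassoc_nat (dQ V g) (dQ W g) (dQ U g)).
Definition dassoci V W U : dhom (dtens V (dtens W U)) (dtens (dtens V W) U) :=
  @mkdhom_inv (dtens (dtens V W) U) (dtens V (dtens W U)) (dassoc V W U)
    (tassoci V W U) (tassocK V W U) (tassociK V W U).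
Fact dassocK V W U :
  @mutual_inverse k dmod_lincat _ _ (dassoc V W U) (dassoci V W U).
Proof. by split; apply: dhom_inj; [exact: tassocK | exact: tassociK]. Qed.
Fact dassoc_nat V V' W W' U U' (f : dhom V V') (g : dhom W W') (h : dhom U U') :
  dhom_cmp (dassoc V' W' U') (dtmor (dtmor f g) h) =
  dhom_cmp (dtmor f (dtmor g h)) (dassoc V W U).
Proof. by apply: dhom_inj; exact: tassoc_nat. Qed.

Fact dlunit_P V m : (tlunit V \o dP (dtens dunit V) m = dP V m \o tlunit V)%VF.
Proof.
apply: (@tens_homext dunit) => a b v w va wb; rewrite !comp_lfunE.
rewrite (dP_neq _ (tens_grade (dunit_grade v) wb)) tlunitE linearZ /= mul1g.
by rewrite (dP_neq _ wb); case: eqP; rewrite ?tlunitE // linear0 scaler0.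
Qed.
Definition dlunit V : dhom (dtens dunit V) V :=
  mkdhom (dtens dunit V) V (tlunit V) (dlunit_P V) (fun g => tlunit_nat (dQ V g)).
Fact drunit_P V m : (trunit V \o dP (dtens V dunit) m = dP V m \o trunit V)%VF.
Proof.
apply: (@tens_homext V dunit) => a b v w va wb; rewrite !comp_lfunE.
rewrite (dP_neq _ (tens_grade va (dunit_grade w))) trunitE linearZ /= mulg1.
by rewrite (dP_neq _ va); case: eqP; rewrite ?trunitE // linear0 scaler0.
Qed.
Definition drunit V : dhom (dtens V dunit) V :=
  mkdhom (dtens V dunit) V (trunit V) (drunit_P V) (fun g => trunit_nat (dQ V g)).
Fact dlunit_iso V : @is_iso k dmod_lincat _ _ (dlunit V).
Proof.
exists (@mkdhom_inv (dtens dunit V) V (dlunit V) _ (tlunitK V) (tlunitiK V)).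
by split; apply: dhom_inj; [exact: tlunitK | exact: tlunitiK].
Qed.
Fact drunit_iso V : @is_iso k dmod_lincat _ _ (drunit V).
Proof.
exists (@mkdhom_inv (dtens V dunit) V (drunit V) _ (trunitK V) (trunitiK V)).
by split; apply: dhom_inj; [exact: trunitK | exact: trunitiK].
Qed.
Fact dlunit_nat V W (f : dhom V W) :
  dhom_cmp (dlunit W) (dtmor (dhom_id dunit) f) = dhom_cmp f (dlunit V).
Proof. by apply: dhom_inj; exact: tlunit_nat. Qed.
Fact drunit_nat V W (f : dhom V W) :
  dhom_cmp (drunit W) (dtmor f (dhom_id dunit)) = dhom_cmp f (drunit V).
Proof. by apply: dhom_inj; exact: trunit_nat. Qed.
Fact dpentagon V W U Z :
  dhom_cmp (dassoc V W (dtens U Z)) (dassoc (dtens V W) U Z) =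
  dhom_cmp (dtmor (dhom_id V) (dassoc W U Z))
    (dhom_cmp (dassoc V (dtens W U) Z) (dtmor (dassoc V W U) (dhom_id Z))).
Proof. by apply: dhom_inj; exact: tpentagon. Qed.
Fact dtriangle V W :
  dhom_cmp (dtmor (dhom_id V) (dlunit W)) (dassoc V dunit W) =
  dtmor (drunit V) (dhom_id W).
Proof. by apply: dhom_inj; exact: ttriangle. Qed.

Definition dmod_tencat : tencat k :=
  @TenCat k dmod_lincat dunit dtens dtmor dtmor_bilin dtmor1 dtmorM
    dassoc dassoci dassocK dassoc_nat
    dlunit dlunit_iso dlunit_nat drunit drunit_iso drunit_nat dpentagon dtriangle.

(* R_{VW}(v (x) w) = \sum_m Q_W(bd m) w (x) P_V(m) v *)
Definition dR (V W : dmod) : 'Hom(tensV V W, tensV W V) :=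
  tlift (fun (v : V) (w : W) => \sum_m tensv (dQ W (cm_bd X m) w) (dP V m v)).
Definition dRi (V W : dmod) : 'Hom(tensV W V, tensV V W) :=
  tlift (fun (w : W) (v : V) => \sum_m tensv (dP V m v) (dQ W (cm_bd X m^-1%g) w)).

Lemma dRE V W a (v : V) (w : W) : v \in dgrade V a ->
  dR V W (tensv v w) = tensv (dQ W (cm_bd X a) w) v.
Proof.
move=> va; rewrite /dR tliftE; last first.
  by apply: bilin_sum => m; apply/bilinC/bilin_lfun2/tensv_bilin.
rewrite (bigD1 a) //= (dPE va) big1 ?addr0 // => m /negPf ma.
by rewrite (dP_neq _ va) ma (bilin0r (tensv_bilin _ _)).
Qed.

Lemma dRiE V W a (v : V) (w : W) : v \in dgrade V a ->
  dRi V W (tensv w v) = tensv v (dQ W (cm_bd X a^-1%g) w).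
Proof.
move=> va; rewrite /dRi tliftE; last first.
  by apply: bilin_sum => m; apply/bilinC/bilin_lfun2/tensv_bilin.
rewrite (bigD1 a) //= (dPE va) big1 ?addr0 // => m /negPf ma.
by rewrite (dP_neq _ va) ma (bilin0l (tensv_bilin _ _)).
Qed.

Lemma dQK V g (x : dsp V) : dQ V g (dQ V g^-1%g x) = x.
Proof. by rewrite -comp_lfunE -dQM mulgV dQ1 id_lfunE. Qed.
Lemma dQKV V g (x : dsp V) : dQ V g^-1%g (dQ V g x) = x.
Proof. by rewrite -comp_lfunE -dQM mulVg dQ1 id_lfunE. Qed.

Fact dRK V W : (dRi V W \o dR V W = \1)%VF.
Proof.
apply: tens_homext => a b v w va wb; rewrite comp_lfunE (dRE _ va) (dRiE _ va).
by rewrite cm_bdV dQKV id_lfunE.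
Qed.
Fact dRiK V W : (dR V W \o dRi V W = \1)%VF.
Proof.
apply: tens_homext => b a w v wb va; rewrite comp_lfunE (dRiE _ va) (dRE _ va).
by rewrite cm_bdV dQK id_lfunE.
Qed.

Fact dR_P V W m : (dR V W \o tensP V W m = tensP W V m \o dR V W)%VF.
Proof.
apply: tens_homext => a b v w va wb; rewrite !comp_lfunE (dRE _ va).
rewrite (tensPE _ (dQgrade _ wb) va) (tensPE _ va wb).
rewrite -cm_bdV cm_peiffer conjgE invgK -!mulgA mulVg mulg1.
by case: eqP; rewrite ?linear0 // (dRE _ va).
Qed.
Fact dR_Q V W g : (dR V W \o tensQ V W g = tensQ W V g \o dR V W)%VF.
Proof.
apply: tens_homext => a b v w va wb; rewrite !comp_lfunE (dRE _ va) !tmapE.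
rewrite (dRE _ (dQgrade g va)) cm_equiv -!comp_lfunE -!dQM conjgE invgK.
by rewrite -!mulgA mulVg mulg1.
Qed.
Definition dbraid V W : dhom (dtens V W) (dtens W V) :=
  mkdhom (dtens V W) (dtens W V) (dR V W) (dR_P V W) (dR_Q V W).

Fact dbraid_iso V W : @is_iso k dmod_tencat _ _ (dbraid V W).
Proof.
exists (@mkdhom_inv (dtens V W) (dtens W V) (dbraid V W) _ (dRK V W) (dRiK V W)).
by split; apply: dhom_inj; [exact: dRK | exact: dRiK].
Qed.
Fact dbraid_nat V V' W W' (f : dhom V V') (g : dhom W W') :
  dhom_cmp (dbraid V' W') (dtmor f g) = dhom_cmp (dtmor g f) (dbraid V W).
Proof.
apply: dhom_inj => /=; apply: tens_homext => a b v w va wb.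
rewrite !comp_lfunE (dRE _ va) !tmapE (dRE _ (dhom_grade f va)).
by rewrite -!comp_lfunE dhomQE.
Qed.
Fact dhexagonr V W U :
  dhom_cmp (dassoc W U V) (dhom_cmp (dbraid V (dtens W U)) (dassoc V W U)) =
  dhom_cmp (dtmor (dhom_id W) (dbraid V U))
    (dhom_cmp (dassoc W V U) (dtmor (dbraid V W) (dhom_id U))).
Proof.
apply: dhom_inj => /=; apply: tens3_homext => a b c v w u va wb uc.
rewrite !comp_lfunE tassocE tmapE (dRE _ va) (@dRE V (dtens W U) a _ _ va) /=.
by rewrite id_lfunE !tmapE !tassocE tmapE id_lfunE (dRE _ va).
Qed.
Fact dhexagonl V W U :
  dhom_cmp (dassoci U V W) (dhom_cmp (dbraid (dtens V W) U) (dassoci V W U)) =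
  dhom_cmp (dtmor (dbraid V U) (dhom_id W))
    (dhom_cmp (dassoci V U W) (dtmor (dhom_id V) (dbraid W U))).
Proof.
apply: dhom_inj => /=; apply: (@tens_homext V (dtens W U)) => a d v x va _.
rewrite -tensrE -!comp_lfunE; congr (fun_of_lfun _ x).
apply: tens_homext => b c w u wb uc.
rewrite !comp_lfunE tensrE tassociE tmapE (dRE _ wb) id_lfunE.
rewrite (@dRE (dtens V W) U (a * b)%g _ _ (tens_grade va wb)) !tassociE.
by rewrite tmapE (dRE _ va) id_lfunE cm_bdM dQM comp_lfunE.
Qed.

Definition MX : braided_tencat k :=
  @BraidedTenCat k dmod_tencat dbraid dbraid_iso dbraid_nat dhexagonr dhexagonl.

Lemma transparent_one : @transparent k MX dunit.
Proof.
move=> V; split; apply: dhom_inj => /=.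
  apply: (@tens_homext dunit) => a b v w va wb.
  rewrite !comp_lfunE (dRE _ (dunit_grade v)) cm_bd1 dQ1 id_lfunE.
  rewrite (@dRE V dunit b _ _ wb) /=.
  by rewrite !id_lfunE.
apply: (@tens_homext V dunit) => a b v w va wb.
rewrite !comp_lfunE (dRE _ va) /= id_lfunE (dRE _ (dunit_grade w)) cm_bd1 dQ1.
by rewrite !id_lfunE.
Qed.

Definition MXT : tencat k :=
  @full_tencat k MX (@transparent k MX) transparent_one (@transparent_tens k MX).

End MX.

(* Main.v *)
Require Import Defs.
From HB Require Import structures.
From mathcomp Require Import all_boot all_order all_algebra all_fingroup.
From mathcomp Require Import boolp.
From mathcomp Require Import cyclic separable cyclotomic mxrepresentation.

Set Implicit Arguments.
Unset Strict Implicit.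
Unset Printing Implicit Defensive.

Import GRing.Theory.
Local Open Scope ring_scope.

(** Write K = ker bd and I = Im bd.  An object V of M(X) is transparent exactly when
    its grading is supported on K and I acts trivially on it.  Indeed, for v of degree
    a and w of degree b, the double braiding sends v (x) w to
      Q(bd b') v (x) Q(bd a) w,   with b' = b^{(bd a)^-1} the degree of Q(bd a) w.
    If a is in K and I acts trivially on V this is v (x) w.  Conversely, it is enough
    to braid V with a single object, k[X2 x X1] graded by the first factor and permuted
    freely by X1 through the second: a basis vector of degree b detects both bd a = 1
    and Q(bd b) v = v ([transparent_central_supported]).

    So a transparent object is a K-graded space with an action of coker bd that permutes
    the degrees.  Since K is abelian and k is algebraically closed of characteristic zero,
    a K-grading is the same as an action of the character group K^*: on V_x the character
    chi acts by the scalar chi x, and conversely the projection onto V_x is the Fourier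
    average
      1/|K| sum_chi (chi x)^-1 chi.
    The compatibility of grading and action, Q(g) V_x = V_{x^{g^-1}}, is then
    precisely the commutation relation of the semidirect product G(X).  Products of
    weights are weights of tensor products, so both translations keep the underlying
    vector spaces, maps and tensor products, and all the structural isomorphisms of the
    equivalence are identity maps.

    What remains is Fourier inversion on K, i.e. that K has |K| characters with the
    usual orthogonality relations.  The matrices of the regular representation of K
    commute and have finite order, so they are simultaneously diagonalizable; the |K|
    diagonal entries are characters, and the trace of the regular representation says
    that they add up to |K| at 1 and to 0 elsewhere.  Pairing this sum with an arbitrary
    character shows that each character occurs exactly once among them. *)

(** * Characters of a finite abelian group *)

(** The minimal polynomial divides X^N - 1, which is split, and separable because N is
    invertible in k. *)
Lemma diagonalizable_unity_root (k : closedFieldType) n N (A : 'M[k]_n.+1) :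
  N%:R != 0 :> k -> A ^+ N = 1 -> diagonalizable A.
Proof.
move=> nzN AN; apply/diagonalizableP.
have [rs Drs] := closed_field_poly_normal ('X^N - 1 : {poly k}).
have N_gt0 : (0 < N)%N by case: (N) nzN => //; rewrite eqxx.
have Ers : 'X^N - 1 = \prod_(z <- rs) ('X - z%:P) :> {poly k}.
  by rewrite Drs lead_coefXnsubC // scale1r.
exists rs; first by rewrite -separable_prod_XsubC -Ers separable_Xn_sub_1.
rewrite -Ers; apply/mxminpoly_minP.
by rewrite rmorphB rmorphXn /= horner_mx_X rmorph1 AN subrr.
Qed.

Lemma abelian_repr_codiagonalizable (k : closedFieldType) (gT : finGroupType)
    (G : {group gT}) n (rG : mx_representation k G n) :
  abelian G -> #|G|%:R != 0 :> k ->
  exists2 P : 'M[k]_n, P \in unitmx &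
    forall x, x \in G -> is_diag_mx (P *m rG x *m invmx P).
Proof.
move=> abG nzG.
have [] := (codiagonalizableP [seq rG x | x <- enum G]).1; last first.
  move=> P Pu /allP Pd; exists P => // x Gx.
  by rewrite -conjumx //; apply: Pd; rewrite map_f ?mem_enum.
split=> [_ _ /mapP[x + ->] /mapP[y + ->]|_ /mapP[x + ->]]; rewrite !mem_enum.
  by move=> Gx Gy; rewrite /comm_mx -!repr_mxM // (centsP abG).
move=> Gx; case: n rG => [|n] rG; first by rewrite thinmx0; exact: diagonalizable0.
apply: (diagonalizable_unity_root nzG).
by rewrite -repr_mxX // expg_cardG // repr_mx1.
Qed.

(** The diagonal entries of the codiagonalized regular representation.  The family is
    produced without knowing that its members are distinct; the trace identity, the
    only orthogonality stated here, is what later implies it. *)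
Lemma abelian_char_family (k : closedFieldType) (gT : finGroupType)
    (G : {group gT}) :
  abelian G -> #|G|%:R != 0 :> k ->
  exists chi : 'I_#|G| -> gT -> k,
    [/\ forall i, chi i 1%g = 1,
        forall i, {in G &, {morph chi i : x y / (x * y)%g >-> x * y}} &
        {in G, forall x, \sum_i chi i x = (#|G| * (x == 1%g))%:R}].
Proof.
move=> abG nzG; pose R := regular_repr k G.
have [P Pu Pd] := abelian_repr_codiagonalizable R abG nzG.
pose D x : 'M_#|G| := P *m R x *m invmx P.
have D1 : D 1%g = 1%:M by rewrite /D repr_mx1 mulmx1 mulmxV.
have DM : {in G &, forall x y, D (x * y)%g = D x *m D y}.
  by move=> x y Gx Gy; rewrite /D repr_mxM // !mulmxA mulmxKV.
exists (fun i x => D x i i); split=> [i|i x y Gx Gy|x Gx].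
- by rewrite D1 mxE eqxx.
- rewrite DM // mxE (bigD1 i) //= big1 ?addr0 // => j ji.
  have /is_diag_mxP Dx := Pd x Gx.
  by rewrite [D x i j]Dx ?mul0r // eq_sym.
transitivity (\tr (R x)).
  by rewrite -/(mxtrace _) /D mxtrace_mulC mulmxA mulVmx ?mul1mx.
rewrite /mxtrace.
transitivity (\sum_(i < #|G|) (x == 1%g)%:R : k).
  apply: eq_bigr => i _; rewrite !mxE eqxx /= -(inj_eq enum_val_inj).
  (* x fixes a point of the regular action only when x = 1 *)
  rewrite gring_indexK ?groupM ?enum_valP //; congr (_%:R).
  by rewrite -{1}[enum_val i]mulg1 (inj_eq (mulgI _)) eq_sym.
by rewrite sumr_const card_ord -mulrnA mulnC.
Qed.

(** * The dual of the kernel of the boundary map *)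

Section Dual.
Variables (k : closedFieldType) (X : crossed_module).
Hypothesis char_k : [pchar k] =i pred0.
Local Notation K := [subg cm_ker X].
Local Notation N := #|[set: K]|.

Lemma cm_ker_subg_abelian : abelian [set: K].
Proof.
apply/centsP => x _ y _; apply: subg_inj; rewrite !sgvalM ?in_setT //.
have /cm_kerP bx := subgP x.
by apply/commute_sym/commgP/conjg_fixP; rewrite -cm_peiffer bx cm_act1.
Qed.

Lemma natr_order_neq0 : N%:R != 0 :> k.
Proof. by rewrite (pcharf0P k).1 // -lt0n cardG_gt0. Qed.

(** Multiplying the sum by a value chi y different from 1 permutes its terms. *)
Lemma sum_kchar_args (chi : kchar k X) :
  \sum_x chi x = (N * (chi == 1%g))%:R.
Proof.
have [->|chi1] := eqVneq chi 1%g.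
  rewrite muln1 -sumr_const; apply: eq_big => [x|x _]; first by rewrite in_setT.
  by rewrite ffunE.
rewrite muln0.
have [y chiy] : exists y, chi y != 1.
  apply/existsP; apply: contraR chi1; rewrite negb_exists => /forallP E.
  by apply/eqP/kchar_inj => y; rewrite ffunE; apply/eqP; rewrite -[_ == _]negbK.
apply/eqP; have : (chi y - 1) * \sum_x chi x == 0.
  rewrite mulrBl mul1r mulr_sumr subr_eq0 [eqbRHS](reindex_inj (mulgI y)).
  by apply/eqP; apply: eq_bigr => x _; rewrite kcharM.
by rewrite mulf_eq0 subr_eq0 (negPf chiy).
Qed.

(** [kchar] carries no finite type structure, since its values lie in an infinite field,
    so its finiteness takes the form of a duplicate-free list of all its elements.  Each
    psi occurs once in the family of [abelian_char_family]: the double sum of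
    chi x / psi x over that family and over K is |K| when summed over chi first, and |K|
    times the multiplicity of psi when summed over x first. *)
Lemma kchar_enum : exists s : seq (kchar k X),
  [/\ uniq s, forall chi, chi \in s &
      forall x, \sum_(chi <- s) chi x = (N * (x == 1%g))%:R].
Proof.
have [f [f1 fM fsum]] := abelian_char_family cm_ker_subg_abelian natr_order_neq0.
have fchar i : is_char [ffun x => f i x].
  apply/is_charP; split=> [|x y]; rewrite !ffunE; first exact: f1.
  by apply: fM; rewrite in_setT.
pose c i : kchar k X := Kchar (fchar i); pose s := [seq c i | i <- index_enum 'I_N].
have s_sum x : \sum_(chi <- s) chi x = (N * (x == 1%g))%:R.
  by rewrite big_map -fsum ?in_setT //; apply: eq_bigr => i _; rewrite ffunE.
have s_count psi : count_mem psi s = 1%N.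
  have: \sum_(chi <- s) \sum_x (chi * psi^-1)%g x = N%:R.
    transitivity (\sum_(x : K) \sum_(chi <- s) chi x / psi x).
      by rewrite exchange_big; do 2!apply: eq_bigr => ? _; rewrite !ffunE.
    under eq_bigr do rewrite -mulr_suml s_sum.
    rewrite (bigD1 1%g) //= big1 => [|x /negPf ->]; last by rewrite muln0 mul0r.
    by rewrite kchar1 eqxx muln1 divr1 addr0.
  under eq_bigr do rewrite sum_kchar_args divg_eq1 natrM.
  rewrite -mulr_sumr -natr_sum -big_mkcond sum1_count -{2}[N%:R]mulr1.
  move/(mulfI natr_order_neq0).
  case: (count_mem _ _) => [/eqP|n /eqP]; first by rewrite eq_sym oner_eq0.
  by rewrite -subr_eq0 -natr1 addrK ((pcharf0P k).1 char_k) => /eqP ->.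
exists s; split=> // [|chi].
  by apply: count_mem_uniq => chi; rewrite -has_pred1 has_count s_count.
by rewrite -has_pred1 has_count s_count.
Qed.

Definition kchars : seq (kchar k X) := sval (cid kchar_enum).

Lemma kchars_uniq : uniq kchars.
Proof. by case: (svalP (cid kchar_enum)). Qed.

Lemma mem_kchars chi : chi \in kchars.
Proof. by case: (svalP (cid kchar_enum)). Qed.

Lemma sum_kchars x : \sum_(chi <- kchars) chi x = (N * (x == 1%g))%:R.
Proof. by case: (svalP (cid kchar_enum)). Qed.

End Dual.

(** * Weight spaces of representations of G(X) *)

Lemma sum_over_kernel (X : crossed_module) (A : zmodType) (F : cm2 X -> A) :
  (forall m, m \notin cm_ker X -> F m = 0) ->
  \sum_m F m = \sum_(x : [subg cm_ker X]) F (sgval x).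
Proof.
move=> F0; rewrite (bigID [in cm_ker X]) /= [X in _ + X]big1 // addr0.
rewrite (reindex_onto (@sgval _ (cm_ker X)) (subg (cm_ker X))) => [|m mK]; last exact: subgK.
by apply: eq_bigl => x; rewrite subgP sgvalK eqxx.
Qed.

Section RepToModule.
Variables (k : closedFieldType) (X : crossed_module).
Hypothesis char_k : [pchar k] =i pred0.
Local Notation K := [subg cm_ker X].
Local Notation N := #|[set: K]|.
Local Notation G := (GX k X).
Implicit Types (V W : rep k G) (chi psi : kchar k X) (x y : K).

Definition chop V chi : 'End(V) := rop V ((chi, 1%g) : G).
Definition ckop V (c : cm_coker X) : 'End(V) := rop V ((1%g, c) : G).

Lemma chopM V chi psi : chop V (chi * psi)%g = (chop V chi \o chop V psi)%VF.
Proof. by rewrite /chop -ropM GX_mulE /= kchar_act1 mulg1. Qed.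

Lemma chop1 V : chop V 1%g = \1%VF. Proof. exact: rop1. Qed.

Lemma ckopM V c d : ckop V (c * d)%g = (ckop V c \o ckop V d)%VF.
Proof. by rewrite /ckop -ropM GX_mulE /= kchar_act1l mulg1. Qed.

Lemma ckop1 V : ckop V 1%g = \1%VF. Proof. exact: rop1. Qed.

(** The commutation relation of the semidirect product: it makes coker bd permute the
    weight spaces. *)
Lemma chop_ckop V chi c :
  (chop V chi \o ckop V c = ckop V c \o chop V (kchar_act chi c))%VF.
Proof.
rewrite /chop /ckop -!ropM !GX_mulE /= kchar_act1 mulg1 mul1g.
by rewrite !mul1g mulg1.
Qed.

Lemma rop_ckop_chop V (p : G) : rop V p = (ckop V p.2 \o chop V p.1)%VF.
Proof.
by rewrite /chop /ckop -ropM GX_mulE /= kchar_act1l mul1g mulg1; case: p.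
Qed.

Definition weight V x (v : V) : Prop := forall chi, chop V chi v = chi x *: v.

Lemma weight_ckop V x c v : weight x v -> weight (cm_kact x c^-1%g) (ckop V c v).
Proof.
by move=> xv chi; rewrite -comp_lfunE chop_ckop comp_lfunE xv linearZ ffunE.
Qed.

Lemma weight_tens V W x y (v : V) (w : W) : weight x v -> weight y w ->
  @weight (rep_tens V W) (x * y)%g (tensv v w).
Proof.
move=> xv yw chi; rewrite /chop /= tmapE -[rop V _]/(chop V chi) xv.
rewrite -[rop W _]/(chop W chi) yw kcharM.
by rewrite (bilinZl (tensv_bilin _ _)) (bilinZr (tensv_bilin _ _)) scalerA.
Qed.

Lemma weight_one (a : k^o) : @weight (rep_one k G) 1%g a.
Proof. by move=> chi; rewrite /chop /= id_lfunE kchar1 scale1r. Qed.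

(** Projection onto the weight space of x, by Fourier inversion. *)
Definition wproj V x : 'End(V) :=
  N%:R^-1 *: \sum_(chi <- kchars X char_k) (chi x)^-1 *: chop V chi.

Lemma wproj_weight V x y v : weight y v ->
  wproj V x v = if x == y then v else 0.
Proof.
move=> yv; rewrite scale_lfunE sum_lfunE.
transitivity (N%:R^-1 *: ((\sum_(chi <- kchars X char_k) chi (y * x^-1)%g) *: v)).
  rewrite scaler_suml; congr (_ *: _); apply: eq_bigr => chi _.
  rewrite scale_lfunE yv scalerA kcharM mulrC; congr (_ * _ *: _).
  apply: (mulfI (kchar_neq0 chi x)).
  by rewrite -kcharM mulgV kchar1 mulfV ?kchar_neq0.
rewrite sum_kchars scalerA divg_eq1 eq_sym; case: eqP => _.
  by rewrite muln1 mulVf ?natr_order_neq0 ?scale1r.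
by rewrite muln0 mulr0 scale0r.
Qed.

(** Applying psi shifts the sum over chi to the sum over psi * chi, at the cost of the
    factor psi x. *)
Lemma weight_wproj V x v : weight x (wproj V x v).
Proof.
move=> psi; rewrite scale_lfunE sum_lfunE linearZ linear_sum /= scalerA.
rewrite [psi x * _]mulrC -scalerA; congr (_ *: _); rewrite scaler_sumr.
rewrite [RHS](perm_big [seq (psi * chi)%g | chi <- kchars X char_k]) /=; last first.
  apply: uniq_perm => [||chi]; first exact: kchars_uniq.
    by rewrite (map_inj_uniq (mulgI psi)) kchars_uniq.
  rewrite mem_kchars; apply/esym/mapP; exists (psi^-1 * chi)%g; rewrite ?mem_kchars //.
  by rewrite mulVKg.
rewrite big_map; apply: eq_bigr => chi _.
rewrite !scale_lfunE linearZ /= chopM comp_lfunE scalerA ffunE invfM mulrA.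
by rewrite mulfV ?kchar_neq0 ?mul1r.
Qed.

Lemma sum_wproj V : \sum_x wproj V x = \1%VF.
Proof.
have sum_inv chi : \sum_x (chi x)^-1 = (N * (chi == 1%g))%:R.
  by rewrite -invg_eq1 -sum_kchar_args; apply: eq_bigr => x _; rewrite ffunE.
rewrite /wproj -scaler_sumr exchange_big (bigD1_seq 1%g) ?mem_kchars ?kchars_uniq //.
rewrite -scaler_suml sum_inv eqxx muln1 big1 => [|chi /negPf chi1] /=.
  by rewrite addr0 chop1 scalerA mulVf ?natr_order_neq0 ?scale1r.
by rewrite -scaler_suml sum_inv chi1 muln0 scale0r.
Qed.

Lemma wproj_sumE V (v : V) : v = \sum_x wproj V x v.
Proof. by rewrite -sum_lfunE sum_wproj id_lfunE. Qed.

(** It suffices to compare the two sides on vectors of weight y, which [ckop V c] turns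
    into vectors of weight y^{c^-1}. *)
Lemma wproj_ckop V x c :
  (wproj V x \o ckop V c = ckop V c \o wproj V (cm_kact x c))%VF.
Proof.
apply/lfunP => v; rewrite (wproj_sumE v) !linear_sum; apply: eq_bigr => y _ /=.
have yv := weight_wproj y v; rewrite !comp_lfunE.
rewrite (wproj_weight _ (weight_ckop c yv)) (wproj_weight _ yv).
have -> : (x == cm_kact y c^-1%g) = (cm_kact x c == y).
  by apply/eqP/eqP => [->|<-]; rewrite -cm_kactM ?mulVg ?mulgV cm_kact1.
by case: eqP; rewrite ?linear0.
Qed.

Lemma wproj_hom V W (f : rep_hom V W) x :
  (f \o wproj V x = wproj W x \o f)%VF.
Proof.
apply/lfunP => v; rewrite !comp_lfunE !scale_lfunE !sum_lfunE linearZ linear_sum.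
congr (_ *: _); apply: eq_bigr => chi _; rewrite !scale_lfunE linearZ /=.
by congr (_ *: _); rewrite -!comp_lfunE -rep_homE.
Qed.

(** * The graded module of a representation *)

Definition repP V (m : cm2 X) : 'End(V) :=
  if m \in cm_ker X then wproj V (subg (cm_ker X) m) else 0.
Definition repQ V (g : cm1 X) : 'End(V) := ckop V (coset (cm_im X) g).

Lemma repP_weight V x v m : weight x v ->
  repP V m v = if m == sgval x then v else 0.
Proof.
move=> xv; rewrite /repP; case: ifPn => [mK|mK].
  rewrite (wproj_weight _ xv); congr (if _ then _ else _).
  by apply/eqP/eqP => [<-|->]; rewrite ?subgK ?sgvalK.
rewrite zero_lfunE; case: eqP => // E; case/negP: mK; rewrite E; exact: subgP.
Qed.

Fact repPP V m n : (repP V m \o repP V n)%VF = if m == n then repP V m else 0.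
Proof.
rewrite {2}/repP; case: ifPn => [nK|nK]; last first.
  by rewrite comp_lfun0r; case: eqP => // ->; rewrite /repP (negPf nK).
apply/lfunP => v; rewrite comp_lfunE (repP_weight _ (weight_wproj _ v)) subgK //.
by case: eqP => [->|_]; rewrite ?zero_lfunE // /repP nK.
Qed.

Lemma repP_sgval V x : repP V (sgval x) = wproj V x.
Proof. by rewrite /repP subgP sgvalK. Qed.

Fact repPsum V : \sum_m repP V m = \1%VF.
Proof.
rewrite sum_over_kernel => [|m mK]; last by rewrite /repP (negPf mK).
by rewrite -sum_wproj; apply: eq_bigr => x _; rewrite repP_sgval.
Qed.

Fact repQ1 V : repQ V 1%g = \1%VF.
Proof. by rewrite /repQ morph1 ckop1. Qed.

Fact repQM V g h : repQ V (g * h)%g = (repQ V g \o repQ V h)%VF.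
Proof. by rewrite /repQ -cm_cosetM ckopM. Qed.

Fact repPQ V m g : (repP V m \o repQ V g = repQ V g \o repP V (cm_act X m g))%VF.
Proof.
have [mK|mK] := boolP (m \in cm_ker X).
  have -> : cm_act X m g = sgval (cm_kact (subg _ m) (coset (cm_im X) g)).
    by rewrite cm_kactE subgK.
  have {1}-> : m = sgval (subg (cm_ker X) m) by rewrite subgK.
  by rewrite !repP_sgval wproj_ckop.
have mgK : cm_act X m g \notin cm_ker X.
  by apply: contra mK => /(cm_ker_act g^-1%g); rewrite cm_actKV.
by rewrite /repP (negPf mK) (negPf mgK) comp_lfun0l comp_lfun0r.
Qed.

Definition rep_dmod V : dmod k X :=
  @Dmod k X V (repP V) (repQ V) (@repPP V) (repPsum V) (repQ1 V) (@repQM V) (repPQ V).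

Lemma rep_dmod_grade V m v : v \in dgrade (rep_dmod V) m ->
  v = 0 \/ exists2 x, m = sgval x & @weight V x v.
Proof.
move/dPE => <- /=; rewrite /repP; case: ifP => [mK|_]; last first.
  by left; rewrite zero_lfunE.
by right; exists (subg (cm_ker X) m); [rewrite subgK | exact: weight_wproj].
Qed.

End RepToModule.

(** * Transparent objects of M(X) *)

Section Transparency.
Variables (k : fieldType) (X : crossed_module).
Local Notation trans := (@transparent k (MX k X)).
Implicit Types V W : dmod k X.

Lemma linfunE (U Z : vectType k) (f : U -> Z) : linear f -> linfun f =1 f.
Proof.
move=> lin u; pose fL : {linear U -> Z} := HB.pack f (GRing.isLinear.Build k U Z _ f lin).
exact: (lfunE fL).
Qed.

(** The object used to detect transparency: functions on X2 x X1, graded by their support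
    in the first factor.  The action moves the delta function at (b, h) to the one at
    (b^{g^-1}, g * h), so distinct g move it to distinct delta functions; the first
    factor provides a homogeneous vector of every degree. *)
Definition test_space : vectType k := {ffun cm2 X * cm1 X -> k^o}.
Implicit Types (f : test_space) (p : cm2 X * cm1 X).

Definition test_proj (m : cm2 X) f : test_space :=
  [ffun p => if p.1 == m then f p else 0].
Definition test_act (g : cm1 X) f : test_space :=
  [ffun p => f (cm_act X p.1 g, (g^-1 * p.2)%g)].

Fact test_proj_linear m : linear (test_proj m).
Proof.
by move=> a f h; apply/ffunP => p; rewrite !ffunE; case: eqP; rewrite ?scaler0 ?addr0.
Qed.
Fact test_act_linear g : linear (test_act g).
Proof. by move=> a f h; apply/ffunP => p; rewrite !ffunE. Qed.

Definition testP m : 'End(test_space) := linfun (test_proj m).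
Definition testQ g : 'End(test_space) := linfun (test_act g).

Fact testPE m f p : testP m f p = if p.1 == m then f p else 0.
Proof. by rewrite (linfunE (test_proj_linear m)) ffunE. Qed.
Fact testQE g f p : testQ g f p = f (cm_act X p.1 g, (g^-1 * p.2)%g).
Proof. by rewrite (linfunE (test_act_linear g)) ffunE. Qed.

Fact testPP m n : (testP m \o testP n)%VF = if m == n then testP m else 0.
Proof.
apply/lfunP => f; apply/ffunP => p; rewrite comp_lfunE !testPE.
have [->|mn] := eqVneq m n; first by rewrite testPE; case: eqP.
by rewrite zero_lfunE ffunE; case: eqP => // ->; rewrite (negPf mn).
Qed.
Fact testPsum : \sum_m testP m = \1%VF.
Proof.
apply/lfunP => f; apply/ffunP => p; rewrite sum_lfunE id_lfunE sum_ffunE.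
rewrite (bigD1 p.1) //= testPE eqxx big1 ?addr0 // => m.
by rewrite testPE eq_sym => /negPf ->.
Qed.
Fact testQ1 : testQ 1%g = \1%VF.
Proof.
apply/lfunP => f; apply/ffunP => p.
by rewrite testQE cm_act1 invg1 mul1g id_lfunE; case: p.
Qed.
Fact testQM g h : testQ (g * h)%g = (testQ g \o testQ h)%VF.
Proof.
apply/lfunP => f; apply/ffunP => p.
by rewrite comp_lfunE !testQE /= cm_actM invMg mulgA.
Qed.
Fact testPQ m g : (testP m \o testQ g = testQ g \o testP (cm_act X m g))%VF.
Proof.
apply/lfunP => f; apply/ffunP => p; rewrite !comp_lfunE testPE !testQE testPE /=.
congr (if _ then _ else _); apply/eqP/eqP => [->|] // E.
by rewrite -(cm_actKV p.1 g) E cm_actKV.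
Qed.

Definition test_dmod : dmod k X := Dmod testPP testPsum testQ1 testQM testPQ.

Definition test_delta p : test_dmod := [ffun q => (q == p)%:R] : test_space.

Lemma test_delta_grade p : test_delta p \in dgrade test_dmod p.1.
Proof.
apply/dgradeP/ffunP => q; rewrite testPE !ffunE.
by case: eqP => // qp; case: eqP => // E; case: qp; rewrite E.
Qed.

Lemma testQ_delta g p :
  dQ test_dmod g (test_delta p) = test_delta (cm_act X p.1 g^-1%g, (g * p.2)%g).
Proof.
apply/ffunP => q; rewrite testQE !ffunE; congr (nat_of_bool _)%:R.
case: p q => [b h] [b' h']; rewrite !xpair_eqE /=.
congr (_ && _); apply/eqP/eqP => [<-|->]; rewrite ?cm_actK ?cm_actKV //.
  by rewrite mulKVg.
by rewrite mulKg.
Qed.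

Definition test_coef V p : 'Hom(tensV V test_space, V) :=
  tlift (fun v f => f p *: v).

Lemma test_coefE V p (v : V) f : test_coef V p (tensv v f) = f p *: v.
Proof.
rewrite tliftE //; split=> [h|w] a x y; last by rewrite !ffunE scalerDl scalerA.
by rewrite scalerDr !scalerA mulrC.
Qed.

Definition central_supported V : Prop :=
  (forall m, m \notin cm_ker X -> dP V m = 0) /\
  (forall g, g \in cm_im X -> dQ V g = \1%VF).

Lemma supported_grade V m (v : dsp V) :
  central_supported V -> v \in dgrade V m -> v = 0 \/ m \in cm_ker X.
Proof.
move=> [P0 _] /dPE <-; have [mK|/P0 ->] := boolP (m \in cm_ker X); first by right.
by left; rewrite zero_lfunE.
Qed.

(** For V supported on ker bd the braiding out of V is the flip, and since Im bd acts
    trivially so is the braiding into V. *)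
Lemma central_supported_transparent V : central_supported V -> trans V.
Proof.
move=> cV; have Q1 m : dQ V (cm_bd X m) = \1%VF.
  by apply: cV.2; rewrite mem_morphim ?in_setT.
move=> W; split; apply: dhom_inj; apply: tens_homext => a b.
  move=> v w va wb; rewrite comp_lfunE (dRE _ va) id_lfunE.
  case: (supported_grade cV va) => [->|/cm_kerP ->].
    by rewrite !(bilin0l (tensv_bilin _ _)) !(bilin0r (tensv_bilin _ _)) linear0.
  by rewrite dQ1 id_lfunE (dRE _ wb) Q1 id_lfunE.
move=> w v wa vb; rewrite comp_lfunE (dRE _ wa) id_lfunE Q1 id_lfunE (dRE _ vb).
case: (supported_grade cV vb) => [->|/cm_kerP ->]; last by rewrite dQ1 id_lfunE.
by rewrite !(bilin0r (tensv_bilin _ _)).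
Qed.

(** The double braiding of v with the delta function at (b, 1) is compared with the
    identity through the coefficients of delta functions in V (x) k[X2 x X1].  If
    bd a != 1 the coefficient at (1, 1) gives v = 0, with b = 1; if bd a = 1 the one at
    (b, 1) gives Q(bd b) v = v. *)
Lemma transparent_central_supported V : trans V -> central_supported V.
Proof.
move=> tV.
have key a b (v : dsp V) : v \in dgrade V a -> forall p,
    (p == (cm_act X b (cm_bd X a)^-1%g, cm_bd X a))%:R *:
      dQ V (cm_bd X (cm_act X b (cm_bd X a)^-1%g)) v = (p == (b, 1%g))%:R *: v.
  move=> va p; have [/(congr1 (@dhom_val _ _ _ _)) E _] := tV test_dmod.
  pose d := test_delta (b, 1%g).
  have {E} : dR test_dmod V (dR V test_dmod (tensv v d)) = tensv v d.
    by rewrite -comp_lfunE [X in fun_of_lfun X _]E id_lfunE.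
  rewrite (dRE _ va) testQ_delta (dRE _ (test_delta_grade _)).
  by move/(congr1 (test_coef V p)); rewrite !test_coefE !ffunE /= mulg1.
have supp a (v : dsp V) : v \in dgrade V a -> a \notin cm_ker X -> v = 0.
  move=> va aK; have := key _ 1%g _ va (1%g, 1%g).
  rewrite eqxx scale1r xpair_eqE => <-.
  have -> : (1%g == cm_bd X a) = false.
    by apply: contraNF aK => /eqP/esym/cm_kerP.
  by rewrite andbF scale0r.
split=> [m mK|_ /morphimP[b _ _ ->]].
  by apply/lfunP => v; rewrite zero_lfunE (supp m (dP V m v)) ?dPgrade.
apply: hom_ext => a v va; rewrite id_lfunE.
have [/cm_kerP aK|aK] := boolP (a \in cm_ker X); last first.
  by rewrite (supp _ _ va aK) linear0.
by have := key _ b _ va (b, 1%g); rewrite aK invg1 cm_act1 eqxx !scale1r.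
Qed.

End Transparency.

(** * The representation of a transparent object *)

Section ModuleToRep.
Variables (k : fieldType) (X : crossed_module) (V : dmod k X).
Hypothesis cV : central_supported V.
Local Notation G := (GX k X).

(** The action descends to coker bd because Im bd acts trivially; the representative
    chosen in the coset is thus irrelevant. *)
Lemma dQ_repr_coset g : dQ V (repr (coset (cm_im X) g)) = dQ V g.
Proof.
rewrite val_coset ?cm_im_norm //.
by have /rcosetP[i iI ->] := mem_repr_rcoset (cm_im X) g; rewrite dQM cV.2 ?comp_lfun1l.
Qed.

(** A pair (chi, c) is the product (1, c)(chi, 1), and chi acts on V_x by chi x. *)
Definition modop (p : G) : 'End(V) :=
  (dQ V (repr p.2) \o \sum_x p.1 x *: dP V (sgval x))%VF.

Lemma modop_grade (chi : kchar k X) g x v : v \in dgrade V (sgval x) ->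
  modop (chi, coset (cm_im X) g) v = chi x *: dQ V g v.
Proof.
move=> vx; rewrite /modop comp_lfunE dQ_repr_coset sum_lfunE (bigD1 x) //= big1.
  by rewrite addr0 scale_lfunE (dPE vx) linearZ.
move=> y /negPf yx; rewrite scale_lfunE (dP_neq _ vx) (inj_eq val_inj) yx.
exact: scaler0.
Qed.

Lemma supported_hom_ext (Y : vectType k) (f h : 'Hom(V, Y)) :
  (forall (x : [subg cm_ker X]) v, v \in dgrade V (sgval x) -> f v = h v) -> f = h.
Proof.
move=> fh; apply: hom_ext => m v vm.
case: (supported_grade cV vm) => [->|mK]; first by rewrite !linear0.
by apply: (fh (subg (cm_ker X) m)); rewrite subgK.
Qed.

Fact modop1 : modop 1%g = \1%VF.
Proof.
apply: supported_hom_ext => x v vx; rewrite id_lfunE.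
have -> : (1%g : G) = (1%g, coset (cm_im X) 1%g) by rewrite morph1.
by rewrite (modop_grade _ _ vx) dQ1 id_lfunE ffunE scale1r.
Qed.

Fact modopM (p q : G) : modop (p * q)%g = (modop p \o modop q)%VF.
Proof.
case: p q => [chi c] [psi d]; elim/cm_coker_ind: c => g; elim/cm_coker_ind: d => h.
apply: supported_hom_ext => x v vx; rewrite comp_lfunE GX_mulE /= cm_cosetM.
rewrite !(modop_grade _ _ vx) linearZ /=.
have hv : dQ V h v \in dgrade V (sgval (cm_kact x (coset (cm_im X) h)^-1%g)).
  by rewrite cm_cosetV cm_kactE; exact: dQgrade.
by rewrite (modop_grade _ _ hv) !ffunE dQM comp_lfunE scalerA mulrC.
Qed.

Definition mod_rep : rep k G := Rep modop1 modopM.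

End ModuleToRep.

(** * The tensor equivalence *)

Section Equivalence.
Variables (k : closedFieldType) (X : crossed_module).
Hypothesis char_k : [pchar k] =i pred0.
Local Notation G := (GX k X).
Local Notation RG := (rep_tencat k G).
Local Notation MT := (MXT k X).

Fact rep_dmod_central (V : rep k G) : central_supported (rep_dmod char_k V).
Proof.
split=> [m mK|g gI] /=; first by rewrite /repP (negPf mK).
by rewrite /repQ coset_id // ckop1.
Qed.

Definition rep_obj (V : RG) : MT :=
  exist _ (rep_dmod char_k V : MX k X)
    (central_supported_transparent (rep_dmod_central V)).

Fact rep_hom_P (V W : rep k G) (f : rep_hom V W) m :
  (f \o repP char_k V m = repP char_k W m \o f)%VF.
Proof.
by rewrite /repP; case: ifP => _; rewrite ?wproj_hom // comp_lfun0l comp_lfun0r.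
Qed.

Definition rep_mor (V W : RG) (f : mor V W) : mor (rep_obj V) (rep_obj W) :=
  @mkdhom k X (rep_dmod char_k V) (rep_dmod char_k W) (f : rep_hom V W)
    (rep_hom_P f) (fun g => rep_homE f _).

Definition rep_functor : functor RG MT.
Proof.
refine (@Functor k RG MT rep_obj rep_mor _ _ _).
- by move=> V W a f g; apply: dhom_inj.
- by move=> V; apply: dhom_inj.
- by move=> V W U g f; apply: dhom_inj.
Defined.

(** The grading of V (x) W defined by weights is the convolution of the gradings of V
    and W, because weights multiply under tensor products. *)
Fact rep_tens_P (V W : rep k G) m :
  repP char_k (rep_tens V W) m =
  tensP (rep_dmod char_k V) (rep_dmod char_k W) m.
Proof.
apply: (@tens_homext _ _ (rep_dmod char_k V) (rep_dmod char_k W) _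
  (repP char_k (rep_tens V W) m)) => a b v w va wb.
rewrite (tensPE _ va wb).
case: (rep_dmod_grade va) => [->|[x ax vx]].
  by rewrite (bilin0l (tensv_bilin _ _)) linear0 if_same.
case: (rep_dmod_grade wb) => [->|[y yb wy]].
  by rewrite (bilin0r (tensv_bilin _ _)) linear0 if_same.
by rewrite (repP_weight _ _ (weight_tens vx wy)) sgvalM ?in_setT // ax yb.
Qed.

Fact rep_one_P m : repP char_k (rep_one k G) m = oneP k m.
Proof.
apply/lfunP => a; rewrite (repP_weight _ _ (weight_one a)) /oneP.
by case: eqP; rewrite ?id_lfunE ?zero_lfunE.
Qed.

Fact rep_mult_P (V W : rep k G) m :
  (\1 \o tensP (rep_dmod char_k V) (rep_dmod char_k W) m =
   repP char_k (rep_tens V W) m \o \1)%VF.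
Proof. by rewrite comp_lfun1l comp_lfun1r rep_tens_P. Qed.

Definition rep_mult (V W : RG) :
    mor (rep_obj V \ox rep_obj W)%cat (rep_obj (V \ox W)%cat) :=
  @mkdhom k X (dtens (rep_dmod char_k V) (rep_dmod char_k W))
    (rep_dmod char_k (rep_tens V W)) \1%VF
    (rep_mult_P V W) (fun g => etrans (comp_lfun1l _) (esym (comp_lfun1r _))).

Fact rep_unit_P m : (\1 \o oneP k m = repP char_k (rep_one k G) m \o \1)%VF.
Proof. by rewrite comp_lfun1l comp_lfun1r rep_one_P. Qed.

Definition rep_unit : mor (tone : MT) (rep_obj tone) :=
  @mkdhom k X (dunit k X) (rep_dmod char_k (rep_one k G)) \1%VF
    rep_unit_P (fun g => etrans (comp_lfun1l _) (esym (comp_lfun1r _))).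

(** Inverses in the full subcategory are only needed as linear maps: [mkdhom_inv] makes
    them morphisms. *)
Fact iso_of_lfun_inverse (V W : MT) (f : mor V W) (h : 'Hom(dsp (sval W), dsp (sval V))) :
  (h \o dhom_val f = \1)%VF -> (dhom_val f \o h = \1)%VF -> is_iso f.
Proof.
by move=> hf fh; exists (mkdhom_inv hf fh); split; apply: dhom_inj.
Qed.

Definition rep_tensor_functor : tensor_functor RG MT.
Proof.
refine (@TensorFunctor k RG MT rep_functor rep_mult rep_unit _ _ _ _ _ _).
- by move=> V W; apply: (@iso_of_lfun_inverse _ _ (rep_mult V W) \1%VF); exact: comp_lfun1l.
- by apply: (@iso_of_lfun_inverse _ _ rep_unit \1%VF); exact: comp_lfun1l.
- move=> V V' W W' f g; apply: dhom_inj => /=.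
  by rewrite comp_lfun1l comp_lfun1r.
- move=> V W U; apply: dhom_inj => /=.
  by rewrite !tmap1 !comp_lfun1r !comp_lfun1l.
- by move=> V; apply: dhom_inj => /=; rewrite !tmap1 !comp_lfun1r.
- by move=> V; apply: dhom_inj => /=; rewrite !tmap1 !comp_lfun1r.
Defined.

Definition mod_obj (Y : MT) : RG :=
  mod_rep (transparent_central_supported (svalP Y)).

Fact mod_hom_subproof (V W : dmod k X) (f : dhom V W) (p : G) :
  (f \o modop V p = modop W p \o f)%VF.
Proof.
rewrite /modop comp_lfunA dhomQE -!comp_lfunA; congr (_ \o _)%VF.
apply/lfunP => v; rewrite !comp_lfunE !sum_lfunE linear_sum; apply: eq_bigr => x _.
by rewrite !scale_lfunE linearZ /= -!comp_lfunE dhomPE.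
Qed.

Definition mod_mor (Y Z : MT) (f : mor Y Z) : mor (mod_obj Y) (mod_obj Z) :=
  @mkrep_hom k G (mod_obj Y) (mod_obj Z) (f : dhom (sval Y) (sval Z))
    (mod_hom_subproof f).

Definition mod_functor : functor MT RG.
Proof.
refine (@Functor k MT RG mod_obj mod_mor _ _ _).
- by move=> V W a f g; apply: rep_hom_inj.
- by move=> V; apply: rep_hom_inj.
- by move=> V W U g f; apply: rep_hom_inj.
Defined.

Fact mod_rep_dmod (V : rep k G) p : modop (rep_dmod char_k V) p = rop V p.
Proof.
rewrite rop_ckop_chop /modop /= /repQ coset_reprK; congr (_ \o _)%VF.
apply/lfunP => v; rewrite sum_lfunE [in RHS](wproj_sumE char_k v) linear_sum.
apply: eq_bigr => x _; rewrite scale_lfunE repP_sgval.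
exact/esym/weight_wproj.
Qed.

Fact rep_dmod_mod_P (V : dmod k X) (cV : central_supported V) m :
  repP char_k (mod_rep cV) m = dP V m.
Proof.
apply: (supported_hom_ext cV) => x v vx; rewrite (dP_neq _ vx).
apply: repP_weight => chi; rewrite /chop /=.
by rewrite -(morph1 (coset (cm_im X))) (modop_grade cV _ _ vx) dQ1 id_lfunE.
Qed.

Fact rep_dmod_mod_Q (V : dmod k X) (cV : central_supported V) g :
  repQ (mod_rep cV) g = dQ V g.
Proof.
apply: (supported_hom_ext cV) => x v vx.
by rewrite /repQ /ckop /= (modop_grade cV _ _ vx) ffunE scale1r.
Qed.

(** Both composites keep the underlying space, and they give back the original operators:
    [mod_rep_dmod] on one side, [rep_dmod_mod_P] and [rep_dmod_mod_Q] on the other.  The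
    natural isomorphisms are identity maps. *)
Lemma rep_functor_equivalence : is_equivalence rep_functor.
Proof.
exists mod_functor; split.
  have id_hom (V : rep k G) (p : G) :
      (\1 \o modop (rep_dmod char_k V) p = rop V p \o \1)%VF.
    by rewrite mod_rep_dmod comp_lfun1l comp_lfun1r.
  have id_homV (V : rep k G) (p : G) :
      (\1 \o rop V p = modop (rep_dmod char_k V) p \o \1)%VF.
    by rewrite mod_rep_dmod comp_lfun1l comp_lfun1r.
  exists (fun V : RG => @mkrep_hom k G (mod_obj (rep_obj V)) V \1%VF (id_hom V)).
  split=> [V|V W f]; last first.
    by apply: rep_hom_inj; rewrite /= comp_lfun1l comp_lfun1r.
  exists (@mkrep_hom k G V (mod_obj (rep_obj V)) \1%VF (id_homV V)).
  by split; apply: rep_hom_inj; rewrite /= comp_lfun1l.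
have id_P (Y : MT) m : (\1 \o repP char_k (mod_obj Y) m = dP (sval Y) m \o \1)%VF.
  by rewrite rep_dmod_mod_P comp_lfun1l comp_lfun1r.
have id_Q (Y : MT) g : (\1 \o repQ (mod_obj Y) g = dQ (sval Y) g \o \1)%VF.
  by rewrite rep_dmod_mod_Q comp_lfun1l comp_lfun1r.
pose eta (Y : MT) : mor (rep_obj (mod_obj Y)) Y :=
  @mkdhom k X (rep_dmod char_k (mod_obj Y)) (sval Y) \1%VF (id_P Y) (id_Q Y).
exists eta; split=> [Y|Y Z f]; last first.
  by apply: dhom_inj; rewrite /= comp_lfun1l comp_lfun1r.
by apply: (@iso_of_lfun_inverse _ _ (eta Y) \1%VF); exact: comp_lfun1l.
Qed.

End Equivalence.

Theorem proposition12 (k : closedFieldType) (char_k : [pchar k] =i pred0)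
    (X : crossed_module) :
  tensor_equivalent (rep_tencat k (GX k X)) (MXT k X).
Proof.
by exists (rep_tensor_functor X char_k); exact: rep_functor_equivalence.
Qed.
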